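(* Let $N\ge 1$ and $p>1+4/N$. Set $\beta:=4/(p-1)$ and $\varphi(x):=|x|^{-\beta}$ on $\mathbb{R}^N$. Then there exists a constant $M^*=M^*(N,p)>0$ such that for all sufficiently small $\varepsilon>0$ there exists a global-in-time solution $u$ to the problem $$\partial_tu+(-\Delta)^2u=|u|^{p-1}u\ \text{ in }\mathbb{R}^N\times(0,\infty),\qquad u(\cdot,0)=\varepsilon\varphi\ \text{ in }\mathbb{R}^N,$$ satisfying $$|u(x,t)|\le\frac{\varepsilon M^*}{|x|^\beta+t^{\beta/4}}\quad\text{for all }(x,t)\in\mathbb{R}^N\times(0,\infty).$$
   Context: $G(x,t)$ denotes the fundamental solution of $\partial_t+(-\Delta)^2$ in $\mathbb{R}^N\times(0,\infty)$: $G(x,t)=(2\pi)^{-N}\int_{\mathbb{R}^N}e^{ix\cdot\xi-t|\xi|^4}\,d\xi$; for each $t>0$, $G(\cdot,t)$ is a Schwartz function. Set $[S(t)\varphi](x):=\int_{\mathbb{R}^N}G(x-y,t)\varphi(y)\,dy$. $BC(\mathbb{R}^N)$ is the space of bounded continuous functions on $\mathbb{R}^N$. Definition of solution: let $\varphi$ be locally integrable and bounded at infinity and let $\varepsilon>0$. A function $u\in C((0,\infty);BC(\mathbb{R}^N))$ is called a global-in-time solution to the problem $$\partial_tu+(-\Delta)^2u=|u|^{p-1}u\ \text{ in }\mathbb{R}^N\times(0,\infty),\qquad u(\cdot,0)=\varepsilon\varphi\ \text{ in }\mathbb{R}^N,$$ if $$u(x,t)=\varepsilon[S(t)\varphi](x)+\int_0^t[S(t-s)F_p(u(s))](x)\,ds\quad\text{for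 all }(x,t)\in\mathbb{R}^N\times(0,\infty),$$ where $F_p(\xi):=|\xi|^{p-1}\xi$ and $u(s)=u(\cdot,s)$. *)

(* Defs.v *)
From HB Require Import structures.
From mathcomp Require Import all_boot all_order all_algebra.
From mathcomp Require Import all_classical all_reals all_analysis.
From mathcomp Require Import complex.

Set Implicit Arguments.
Unset Strict Implicit.
Unset Printing Implicit Defensive.

Import Order.TTheory GRing.Theory Num.Theory.
Import numFieldNormedType.Exports.

Local Open Scope classical_set_scope.
Local Open Scope ring_scope.

(* R^n is 'rV[R]_n: its library topology is the product topology. It gets here
   the product Borel sigma-algebra, generated by the coordinate maps. *)
Section row_vector_measurable.
Variables (R : realType) (n : nat).

Let coord (i : 'I_n) (v : 'rV[R]_n) : R := v ord0 i.

Let rV_set0 : g_sigma_preimage coord set0.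
Proof. exact: sigma_algebra0. Qed.

Let rV_setC A : g_sigma_preimage coord A -> g_sigma_preimage coord (~` A).
Proof. exact: sigma_algebraC. Qed.

Let rV_bigcup (F : (set 'rV[R]_n)^nat) :
  (forall i, g_sigma_preimage coord (F i)) ->
  g_sigma_preimage coord (\bigcup_i F i).
Proof. exact: sigma_algebra_bigcup. Qed.

HB.instance Definition _ := @isMeasurable.Build default_measure_display
  'rV[R]_n (g_sigma_preimage coord) rV_set0 rV_setC rV_bigcup.

Lemma measurable_coord (i : 'I_n) :
  measurable_fun [set: 'rV[R]_n] (fun v : 'rV[R]_n => v ord0 i).
Proof.
move=> _ Y mY; rewrite setTI; apply: sub_sigma_algebra => /=.
rewrite -bigcup_seq/=; exists i => /=; first by rewrite mem_index_enum.
by exists Y => //; rewrite setTI.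
Qed.

Lemma measurable_fun_rV d (T : measurableType d) (f : T -> 'rV[R]_n) :
  (forall i, measurable_fun [set: T] (fun t => f t ord0 i)) ->
  measurable_fun [set: T] f.
Proof.
move=> mf _ A mA; rewrite setTI.
pose G := [set B : set 'rV[R]_n | measurable (f @^-1` B)].
suff : g_sigma_preimage coord `<=` G by move=> /(_ _ mA).
apply: smallest_sub; first split.
- by rewrite /G /= preimage_set0; exact: measurable0.
- by move=> B; rewrite /G /= setTD preimage_setC => mB; exact: measurableC.
- move=> F mF; rewrite /G /= preimage_bigcup.
  by apply: bigcupT_measurable => k; exact: mF.
rewrite -bigcup_seq => B /= [i _ [Y mY <-]].
rewrite /G /= setTI -[X in measurable X]setTI; exact: mf.
Qed.

End row_vector_measurable.

Section lebesgue_measure_rV.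
Variable R : realType.

Definition rV_cons n (p : measurableTypeR R * 'rV[R]_n) : 'rV[R]_n.+1 :=
  \row_(i < n.+1) if unlift ord0 i is Some j then p.2 ord0 j else p.1.

Definition rV_uncons n (v : 'rV[R]_n.+1) : measurableTypeR R * 'rV[R]_n :=
  (v ord0 ord0, \row_(j < n) v ord0 (lift ord0 j)).

Lemma rV_consK n : cancel (@rV_cons n) (@rV_uncons n).
Proof.
move=> [x v]; rewrite /rV_uncons /rV_cons mxE unlift_none /=; congr (_, _).
by apply/rowP => j; rewrite !mxE liftK.
Qed.

Lemma rV_unconsK n : cancel (@rV_uncons n) (@rV_cons n).
Proof.
move=> v; apply/rowP => i; rewrite /rV_cons mxE.
by case: unliftP => [j|] ->; rewrite //= mxE.
Qed.

Lemma measurable_rV_cons n : measurable_fun setT (@rV_cons n).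
Proof.
apply: measurable_fun_rV => i; case: (unliftP ord0 i) => [j ->|->].
- rewrite (_ : (fun _ => _) = (fun v : 'rV[R]_n => v ord0 j) \o snd).
    by apply: measurableT_comp; [exact: measurable_coord|exact: measurable_snd].
  by apply/funext => p; rewrite /rV_cons mxE liftK.
- rewrite (_ : (fun _ => _) = fst); first exact: measurable_fst.
  by apply/funext => p; rewrite /rV_cons mxE unlift_none.
Qed.

Lemma measurable_rV_uncons n : measurable_fun setT (@rV_uncons n).
Proof.
apply/measurable_fun_pairP; split; first exact: measurable_coord.
apply: measurable_fun_rV => i.
rewrite (_ : (fun _ => _) = fun v : 'rV[R]_n.+1 => v ord0 (lift ord0 i)).
  exact: measurable_coord.
by apply/funext => v /=; rewrite mxE.
Qed.

Section successor_dimension.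
Variables (n : nat) (mu : {sigma_finite_measure set 'rV[R]_n -> \bar R}).

Definition lebesgue_rV_succ : set 'rV[R]_n.+1 -> \bar R :=
  pushforward (@lebesgue_measure R \x mu)%E (@rV_cons n).

Let succ0 : lebesgue_rV_succ set0 = 0%E.
Proof. by apply: measure0; exact: measurable_rV_cons. Qed.

Let succ_ge0 A : (0 <= lebesgue_rV_succ A)%E.
Proof. by apply: measure_ge0; exact: measurable_rV_cons. Qed.

Let succ_sigma_additive : semi_sigma_additive lebesgue_rV_succ.
Proof. by apply: measure_semi_sigma_additive; exact: measurable_rV_cons. Qed.

HB.instance Definition _ := isMeasure.Build _ _ _ lebesgue_rV_succ
  succ0 succ_ge0 succ_sigma_additive.

Let sigma_finite_lebesgue_rV_succ : sigma_finite setT lebesgue_rV_succ.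
Proof.
have /sigma_finiteP[F [TF ndF Foo]] := sigma_finiteT (@lebesgue_measure R).
have /sigma_finiteP[H [TH ndH Hoo]] := sigma_finiteT mu.
exists (fun k => @rV_uncons n @^-1` (F k `*` H k)).
  rewrite -preimage_bigcup (_ : \bigcup_k _ = setT) ?preimage_setT//.
  rewrite -setXTT TF TH predeqE => -[x y]; split.
    by move=> [k _ []/= ? ?]; split; exists k.
  move=> [/= [k _ Fkx] [l _ Hly]]; exists (maxn k l) => //; split.
  - by move: x Fkx; exact/subsetPset/ndF/leq_maxl.
  - by move: y Hly; exact/subsetPset/ndH/leq_maxr.
move=> k; have [? ?] := Foo k; have [? ?] := Hoo k; split.
  rewrite -[X in measurable X]setTI; apply: measurable_rV_uncons => //.
  exact: measurableX.
rewrite /lebesgue_rV_succ /pushforward -comp_preimage.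
rewrite (_ : _ \o _ = id) ?preimage_id; last exact/funext/rV_consK.
by rewrite product_measure1E// lte_mul_pinfty// ge0_fin_numE.
Qed.

HB.instance Definition _ := Measure_isSigmaFinite.Build _ _ _ lebesgue_rV_succ
  sigma_finite_lebesgue_rV_succ.

End successor_dimension.

(* Lebesgue measure on R^n, as the n-fold product of the one on R. *)
Fixpoint lebesgue_rV n : {sigma_finite_measure set 'rV[R]_n -> \bar R} :=
  if n is n'.+1 then lebesgue_rV_succ (lebesgue_rV n')
  else \d_ (0 : 'rV[R]_0).

End lebesgue_measure_rV.

Section complex_integral.
Variable R : realType.

Definition expC (z : R[i]) : R[i] :=
  Complex (expR (complex.Re z) * cos (complex.Im z))
          (expR (complex.Re z) * sin (complex.Im z)).

Definition integralC n (f : 'rV[R]_n -> R[i]) : R[i] :=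
  Complex (\int[lebesgue_rV R n]_v complex.Re (f v))
          (\int[lebesgue_rV R n]_v complex.Im (f v)).

End complex_integral.

Section biharmonic_heat.
Variables (R : realType) (N : nat).
Implicit Types (x y xi : 'rV[R]_N) (phi : 'rV[R]_N -> R) (t : R).

Definition dotr x y : R := \sum_(i < N) x ord0 i * y ord0 i.

(* The library norm `|x| on 'rV[R]_N is the sup norm. *)
Definition enorm x : R := Num.sqrt (dotr x x).

(* The integral is real, the imaginary part of the integrand being odd. *)
Definition biharmonic_kernel x t : R :=
  complex.Re (((2 * pi) ^- N)%:C%C *
    integralC (fun xi => expC ('i%C * (dotr x xi)%:C%C
                               - (t * enorm xi ^+ 4)%:C%C))).

Definition biharmonic_semigroup t phi x : R :=
  \int[lebesgue_rV R N]_y (biharmonic_kernel (x - y) t * phi y).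

Definition biharmonic_semigroup_integrable t phi x :=
  (lebesgue_rV R N).-integrable setT
    (fun y => (biharmonic_kernel (x - y) t * phi y)%:E).

Definition Fp (p xi : R) : R := `|xi| `^ (p - 1) * xi.

Definition locally_integrable_rV phi :=
  measurable_fun setT phi /\
  forall K : set 'rV[R]_N, compact K ->
    (lebesgue_rV R N).-integrable K (EFin \o phi).

Definition bounded_at_infinity phi :=
  exists r : R, [bounded phi x | x in [set x | r < enorm x]].

(* u \in C((0,oo); BC(R^N)), the topology of BC(R^N) being uniform convergence;
   the values of u at times t <= 0 are irrelevant. *)
Definition continuous_BC (u : 'rV[R]_N -> R -> R) :=
  (forall t, 0 < t ->
     continuous (u ^~ t) /\ [bounded u x t | x in [set: 'rV[R]_N]]) /\
  {in `]0, +oo[%classic,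
     continuous (fun t => u ^~ t : {uniform 'rV[R]_N -> R})}.

(* Library integrals are total, with junk values outside their domain: the
   convergence of the integrals of the equation is therefore stated. *)
Definition global_solution (p eps : R) phi (u : 'rV[R]_N -> R -> R) :=
  [/\ locally_integrable_rV phi /\ bounded_at_infinity phi,
      continuous_BC u &
      forall x t, 0 < t ->
        let Fpu := fun (s : R) y => Fp p (u y s) in
        [/\ biharmonic_semigroup_integrable t phi x,
            forall s : R, 0 < s < t ->
              biharmonic_semigroup_integrable (t - s) (Fpu s) x,
            (@lebesgue_measure R).-integrable `]0, t[%classic
              (fun s : R => (biharmonic_semigroup (t - s) (Fpu s) x)%:E) &
            u x t = eps * biharmonic_semigroup t phi x
              + \int[@lebesgue_measure R]_(s in `]0, t[%classic)
                  biharmonic_semigroup (t - s) (Fpu s) x]].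

End biharmonic_heat.

(* Main.v *)
(* Write [tau = t^(1/4)]. The kernel obeys [|G(x,t)| <= C tau^N / max(tau,|x|)^(2N)],
   and convolution with this majorant sends [max(|y|,sigma)^(-a)] below
   [C max(|x|,tau)^(-a)] for every [0 <= a < N], with [C] independent of [sigma]
   and [tau]. As [beta < N], this bounds [S(t) phi]. For the Duhamel term choose
   [beta < a < min(N, beta + 4)]: since [beta p = beta + 4],
     [max(|y|,s^(1/4))^(-beta p) <= s^(g - 1) max(|y|,s^(1/4))^(-a)]
   with [g = (a - beta)/4 > 0], an integrable singularity in time; near [s = t] one
   uses [a = 0] instead. Hence the integral equation is a contraction for the norm
   weighted by [max(|x|,t^(1/4))^(-beta)] when [eps] is small. Continuity in time
   and space, uniformly in space, follows by interpolating between a Lipschitz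
   bound on the kernel and its decay. *)

Require Import Defs.
From mathcomp Require Import all_boot all_order all_algebra.
From mathcomp Require Import all_classical all_reals all_analysis measurable_realfun.
From mathcomp Require Import zify ring lra.

Set Implicit Arguments.
Unset Strict Implicit.
Unset Printing Implicit Defensive.

Import Order.TTheory GRing.Theory Num.Theory.
Import numFieldNormedType.Exports.
Local Open Scope classical_set_scope.
Local Open Scope ring_scope.

(** * Lebesgue measure on row vectors *)

(** The obstacle is that the exponent [beta p = beta + 4] of the nonlinearity may exceed [N], where
    convolving the majorant with the weight is no longer bounded uniformly in [sigma]. This forces
    the trade of spatial decay against a singularity at [s = 0]: [a < beta + 4] makes the trade
    possible, [a > beta] makes the resulting power of [s] integrable, and [p > 1 + 4/N] is exactly
    [beta < N], the room in which [a] is chosen. The majorant uses the sup norm because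
    [max(tau,|z|)^2] dominates [(tau^2 + z_i^2) / 2] for every coordinate. Integrals over [R^N] are
    thus bounded by products of integrals over [R], whose primitives are a power and an arctangent.
    The decay of the kernel comes from differences of the symbol along a single frequency axis, so
    that only one-variable calculus on [exp(-(r + z^2)^2)] is needed. The fixed point is a pointwise
    limit of iterates. Each iterate is kept jointly measurable in space and time, since it enters
    the next space-time integral. *)

Section rV_measure.
Context {R : realType}.
Local Open Scope ereal_scope.

Lemma ge0_integral_rV_cons n (f : 'rV[R]_n.+1 -> \bar R) :
  measurable_fun setT f -> (forall v, 0 <= f v) ->
  \int[lebesgue_rV R n.+1]_v f v =
  \int[@lebesgue_measure R]_x \int[lebesgue_rV R n]_v f (rV_cons (x, v)).
Proof.
move=> mf f0.
transitivity (\int[(@lebesgue_measure R \x lebesgue_rV R n)]_z (f \o @rV_cons R n) z).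
  rewrite -[RHS](ge0_integral_pushforward (@measurable_rV_cons R n) _ measurableT mf)//.
rewrite (fubini_tonelli1 (f \o @rV_cons R n))//.
- by apply: measurableT_comp => //; exact: measurable_rV_cons.
- by move=> z; exact: f0.
Qed.

Lemma ge0_integral_shift1 (h : R) (f : R -> \bar R) :
  measurable_fun setT f -> (forall v, 0 <= f v) ->
  \int[@lebesgue_measure R]_x f (x + h)%R = \int[@lebesgue_measure R]_x f x.
Proof.
move=> mf f0.
pose sh : measurableTypeR R -> measurableTypeR R := fun x => (x + h)%R.
have msh : measurable_fun setT sh by exact: measurable_funD.
transitivity (\int[@lebesgue_measure R]_(x in sh @^-1` setT) (f \o sh) x) => //.
rewrite -ge0_integral_pushforward//.
(* The image of Lebesgue measure under a translation agrees with it on half-open intervals, hence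
   everywhere by uniqueness. *)
apply: eq_measure_integral => A mA _; apply/esym/lebesgue_measure_unique => //.
move=> _ [[a b]] _ <-; rewrite /= /pushforward.
have -> : sh @^-1` `]a, b]%classic = `](a - h)%R, (b - h)%R]%classic.
  by apply/seteqP; split => x /=; rewrite !in_itv/= ltrBlDr lerBrDr.
rewrite !lebesgue_measure_itv/= !lte_fin ltrD2r; case: ifP => // _.
by rewrite !EFinN -!EFinD; congr EFin; ring.
Qed.

Lemma measurable_shift_rV n (h : 'rV[R]_n) :
  measurable_fun setT (fun v : 'rV[R]_n => (v + h)%R).
Proof.
apply: measurable_fun_rV => i.
under eq_fun do rewrite mxE.
by apply: measurable_funD => //; exact: measurable_coord.
Qed.

Lemma ge0_integral_shift n (h : 'rV[R]_n) (f : 'rV[R]_n -> \bar R) :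
  measurable_fun setT f -> (forall v, 0 <= f v) ->
  \int[lebesgue_rV R n]_x f (x + h)%R = \int[lebesgue_rV R n]_x f x.
Proof.
elim: n h f => [|n IH] h f mf f0.
  by apply: eq_integral => x _; congr f; apply/rowP => -[].
have mfh m (k : 'rV[R]_m) (g : 'rV[R]_m -> \bar R) : measurable_fun setT g ->
    measurable_fun setT (fun v : 'rV[R]_m => g (v + k)%R).
  move=> mg; apply: measurableT_comp => //; exact: measurable_shift_rV.
rewrite (ge0_integral_rV_cons (mfh _ h f mf)) ?(ge0_integral_rV_cons mf)//.
have consD x v : (rV_cons (x, v) + h)%R =
    rV_cons ((x + h ord0 ord0)%R, (v + \row_j h ord0 (lift ord0 j))%R).
  apply/rowP => i; rewrite !mxE; case: (unliftP ord0 i) => [j|] -> //.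
  by rewrite !mxE.
have mfc x : measurable_fun setT (fun v : 'rV[R]_n => f (rV_cons (x, v))).
  apply: (measurableT_comp mf).
  by apply: (measurableT_comp (@measurable_rV_cons R n)); exact: measurable_pair1.
under eq_integral => x _.
  under eq_integral do rewrite consD.
  rewrite (IH (\row_j h ord0 (lift ord0 j)) (fun v => f (rV_cons ((x + h ord0 ord0)%R, v))))//.
  over.
rewrite (ge0_integral_shift1 (h ord0 ord0)
  (f := fun x => \int[lebesgue_rV R n]_v f (rV_cons (x, v))))//.
- apply: (measurable_fun_fubini_tonelli_F (f \o @rV_cons R n)).
  + by apply: measurableT_comp => //; exact: measurable_rV_cons.
  + by move=> z; exact: f0.
- by move=> x; apply: integral_ge0 => v _; exact: f0.
Qed.

Lemma Rintegral_shift n (h : 'rV[R]_n) (f : 'rV[R]_n -> R) :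
  measurable_fun setT f ->
  (\int[lebesgue_rV R n]_x f (x + h) = \int[lebesgue_rV R n]_x f x)%R.
Proof.
move=> /measurable_EFinP mf; congr fine; rewrite integralE [RHS]integralE.
congr (_ - _).
- rewrite -[RHS](ge0_integral_shift h (f := (EFin \o f)^\+))//; last first.
    exact: measurable_funepos.
  by apply: eq_integral => x _; rewrite !funeposE.
- rewrite -[RHS](ge0_integral_shift h (f := (EFin \o f)^\-))//; last first.
    exact: measurable_funeneg.
  by apply: eq_integral => x _; rewrite !funenegE.
Qed.

(** The passage from one dimension to [n]: both the majorant and the frequency weight are controlled
    by products over coordinates and integrated through this bound. *)
Lemma ge0_integral_tensor_le n (g : 'I_n -> R -> R) (c : R) :
  (forall i, measurable_fun setT (g i)) -> (forall i x, (0 <= g i x)%R) ->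
  (forall i, \int[@lebesgue_measure R]_x (g i x)%:E <= c%:E) ->
  \int[lebesgue_rV R n]_v (\prod_(i < n) g i (v ord0 i))%:E <= (c ^+ n)%:E.
Proof.
elim: n g => [|n IH] g mg g0 gc.
  under eq_integral do rewrite big_ord0.
  (* In dimension 0 the measure is a Dirac mass and the empty product is 1. *)
  by rewrite expr0 /= integral_dirac// diracT mul1e.
have mprod m (k : 'I_m -> R -> R) : (forall i, measurable_fun setT (k i)) ->
   measurable_fun setT (fun v : 'rV[R]_m => (\prod_(i < m) k i (v ord0 i))%:E).
  move=> mk; apply/measurable_EFinP; apply: measurable_prod => i _.
  by apply: measurableT_comp => //; exact: measurable_coord.
have c0 : 0 <= c%:E by apply: le_trans (gc ord0); apply: integral_ge0 => x _; rewrite lee_fin.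
rewrite ge0_integral_rV_cons//; last 2 first.
- exact: mprod.
- by move=> v; rewrite lee_fin; exact: prodr_ge0.
under eq_integral => x _.
  under eq_integral => v _.
    rewrite big_ord_recl /= {1}/rV_cons mxE unlift_none/=.
    under eq_bigr do rewrite /rV_cons mxE liftK/=.
    rewrite EFinM; over.
  rewrite ge0_integralZl//; [over| | |].
  - exact: (mprod _ (fun i => g (lift ord0 i))).
  - by move=> v _; rewrite lee_fin; exact: prodr_ge0.
  - by rewrite lee_fin.
rewrite ge0_integralZr//; last 3 first.
- by move/measurable_EFinP: (mg ord0).
- by move=> x _; rewrite lee_fin.
- by apply: integral_ge0 => v _; rewrite lee_fin; exact: prodr_ge0.
rewrite exprS EFinM; apply: lee_pmul => //.
- by apply: integral_ge0 => x _; rewrite lee_fin.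
- by apply: integral_ge0 => v _; rewrite lee_fin; exact: prodr_ge0.
- exact: (IH (fun i => g (lift ord0 i))).
Qed.
End rV_measure.

(** Tonelli applies to the positive and negative parts separately, and [fine] is measurable, so
    divergent integrals do no harm. This keeps the kernel and the Duhamel term jointly
    measurable. *)
Lemma measurable_Rintegral {R : realType} d1 d2 (X : measurableType d1)
  (Y : measurableType d2) (m : {sigma_finite_measure set Y -> \bar R})
  (f : X * Y -> R) :
  measurable_fun setT f -> measurable_fun setT (fun x => \int[m]_y f (x, y)).
Proof.
move=> /measurable_EFinP mf; apply: measurableT_comp => //.
under eq_fun do rewrite integralE.
apply: emeasurable_funB.
- have /(_ (measurable_funepos mf) (fun=> funepos_ge0 _ _)) :=
    @measurable_fun_fubini_tonelli_F _ _ X Y R m ((EFin \o f)^\+)%E.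
  rewrite /fubini_F; apply: eq_measurable_fun => x _; apply: eq_integral => y _.
  by rewrite !funeposE.
- have /(_ (measurable_funeneg mf) (fun=> funeneg_ge0 _ _)) :=
    @measurable_fun_fubini_tonelli_F _ _ X Y R m ((EFin \o f)^\-)%E.
  rewrite /fubini_F; apply: eq_measurable_fun => x _; apply: eq_integral => y _.
  by rewrite !funenegE.
Qed.

(** * Integrals over the real line *)

Section line.
Context {R : realType}.
Local Notation mu := (@lebesgue_measure R).

Lemma ge0_integral_even (f : R -> \bar R) :
  measurable_fun setT f -> (forall x, 0 <= f x)%E -> (forall x, f (- x) = f x) ->
  (\int[mu]_x f x = \int[mu]_(x in `[0%R, +oo[) f x + \int[mu]_(x in `[0%R, +oo[) f x)%E.
Proof.
move=> mf f0 fe.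
rewrite {2}ge0_integration_by_substitution0//.
under [X in (_ + X)%E]eq_integral do rewrite fe.
rewrite -integral_itv_bndo_bndc; last exact: measurable_funTS.
rewrite -(setCitvr (BLeft 0)) -ge0_integral_setU//.
- by rewrite setUv.
- exact: measurableC.
- by rewrite setUv.
- by apply/disj_setPCl.
Qed.

Lemma ge0_integral_powR_le (g t : R) : 0 < g -> 0 < t ->
  (\int[mu]_(s in `]0%R, t[) (s `^ (g - 1))%:E <= (t `^ g / g)%:E)%E.
Proof.
move=> g0 t0.
(* For [g < 1] the integrand is singular at 0, so the fundamental theorem is applied on these
   intervals, which exhaust []0, t]]. Starting the denominators at 2 makes each of them
   nondegenerate. *)
pose F (i : nat) : set R := `[t / i.+2%:R, t]%classic.
have mpow : measurable_fun setT (fun s : R => (s `^ (g - 1))%:E).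
  by apply/measurable_EFinP; exact: measurable_powR.
have FU : \bigcup_i F i = `]0, t]%classic.
  apply/seteqP; split => s /=.
    move=> [i _]; rewrite /F /= !in_itv/= => /andP[h ->]; rewrite andbT.
    by apply: lt_le_trans h; rewrite divr_gt0.
  rewrite in_itv/= => /andP[s0 st].
  have [n hn] : exists n : nat, t / s < n%:R.
    by exists (Num.bound (t / s)); apply: archi_boundP; rewrite divr_ge0 ?ltW.
  exists n => //; rewrite /F /= in_itv/= st andbT ler_pdivrMr// mulrC.
  rewrite -ler_pdivrMr//; apply/ltW/(lt_le_trans hn).
  by rewrite ler_nat; lia.
rewrite integral_itv_bndo_bndc; last exact: measurable_funTS.
rewrite -FU.
have cv : (\int[mu]_(x in F i) (x `^ (g - 1))%:E @[i --> \oo] -->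
    \int[mu]_(x in \bigcup_i F i) (x `^ (g - 1))%:E)%E.
  apply: ge0_nondecreasing_set_cvg_integral.
  - move=> m n mn; apply/subsetPset => s; rewrite /F /= !in_itv/= => /andP[h ->].
    rewrite andbT; apply: le_trans h.
    by rewrite ler_pM2l// lef_pV2 ?posrE ?ltr0n// ler_nat; lia.
  - by move=> i; rewrite /F.
  - by move=> i; exact: measurable_funTS.
  - by move=> i x _; rewrite lee_fin powR_ge0.
rewrite -(cvg_lim _ cv)//; apply: lime_le; first by apply/cvg_ex; eexists; exact: cv.
apply: nearW => i.
have ai : 0 < t / i.+2%:R by rewrite divr_gt0.
have ait : t / i.+2%:R < t.
  by rewrite ltr_pdivrMr// ltr_pMr// ltr1n.
have dF (s : R) : 0 < s -> is_derive s 1 (fun s => s `^ g / g) (s `^ (g - 1)).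
  move=> s0; have h := is_derive1_powR g s0.
  have -> : (fun s : R => s `^ g / g) = (fun s => g^-1 * s `^ g).
    by apply/funext => z; rewrite mulrC.
  have := @is_deriveZ _ _ _ (fun s : R => s `^ g) g^-1 s 1 _ h.
  have -> : g^-1 *: (g * s `^ (g - 1)) = s `^ (g - 1).
    by rewrite /GRing.scale/= mulKf// gt_eqF.
  by [].
have cpow : {within `[t / i.+2%:R, t], continuous (fun s : R => s `^ (g - 1))}.
  apply: derivable_within_continuous => s; rewrite in_itv/= => /andP[h _].
  by apply: ex_derive; apply: is_derive1_powR; exact: lt_le_trans h.
have cF (s : R) : 0 < s -> {for s, continuous (fun s : R => s `^ g / g)}.
  move=> s0; apply: differentiable_continuous; apply/derivable1_diffP.
  by apply: ex_derive; exact: dF.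
rewrite (@continuous_FTC2 _ _ (fun s => s `^ g / g))//.
- by rewrite -EFinB lee_fin gerBl divr_ge0 ?powR_ge0 ?ltW.
- split.
  + move=> s; rewrite in_itv/= => /andP[h _]; apply: ex_derive.
    by apply: dF; exact: lt_trans h.
  + by apply: cvg_at_right_filter; exact: cF.
  + by apply: cvg_at_left_filter; exact: cF.
- move=> s; rewrite in_itv/= => /andP[h _]; rewrite derive1E.
  by have /(@derive_val _ _ _ _ _ _ _) := dF _ (lt_trans ai h).
Qed.

(** The integrand is [2 pi] times the Cauchy density of scale [tau] centred at [x]. That its mass is
    free of [tau] and [x] makes the convolution constants uniform in time and space. *)
Lemma integral_cauchy (tau x : R) : 0 < tau ->
  (\int[mu]_z (2 * tau / (tau ^+ 2 + (x - z) ^+ 2))%:E = (2 * pi)%:E)%E.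
Proof.
move=> tau0.
pose f (z : R) := 2 * tau / (tau ^+ 2 + z ^+ 2).
have den0 (z : R) : 0 < tau ^+ 2 + z ^+ 2.
  by rewrite ltr_wpDr ?sqr_ge0 ?exprn_gt0.
have cf : continuous f.
  move=> z; apply: cvgM; first exact: cvg_cst.
  apply: cvgV; first by rewrite gt_eqF.
  by apply: cvgD; [exact: cvg_cst|exact: exprn_continuous].
have mf : measurable_fun setT (EFin \o f).
  by apply/measurable_EFinP; exact: continuous_measurable_fun.
have f0 z : (0 <= (EFin \o f) z)%E.
  by rewrite lee_fin divr_ge0 ?mulr_ge0 ?ltW.
transitivity (\int[mu]_z (EFin \o f) (z + - x)%R)%E.
  by apply: eq_integral => z _; rewrite /= /f -(opprB z x) sqrrN.
rewrite ge0_integral_shift1// ge0_integral_even//; last first.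
  by move=> z; rewrite /= /f sqrrN.
have dF (z : R) : is_derive z 1 (fun z => 2 * atan (z / tau)) (f z).
  have h : is_derive z (1:R) (fun z : R => z / tau) (tau^-1).
    have := @is_deriveZ _ _ _ (@id R) tau^-1 z 1 _ (is_derive_id _ _).
    rewrite /GRing.scale/= mulr1.
    by have -> : tau^-1 \*: @id R = (fun z : R => z / tau)
      by apply/funext => w; rewrite /GRing.scale/= mulrC.
  have := @is_derive1_comp _ atan (fun z => z / tau) z _ _ (is_derive1_atan _) h.
  move/(@is_deriveZ _ _ _ _ 2 _ _ _).
  have -> : 2 *: ((1 + (z / tau) ^+ 2)^-1 * tau^-1) = f z.
    rewrite /f /GRing.scale/=; have := den0 z; have := tau0 => h1 h2.
    by field; rewrite !gt_eqF//= addrC.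
  by [].
have cF : continuous (fun z : R => 2 * atan (z / tau)).
  move=> z; apply: differentiable_continuous; apply/derivable1_diffP.
  by apply: ex_derive; exact: dF.
have -> : (\int[mu]_(z in `[0%R, +oo[) (EFin \o f) z = pi%:E)%E.
  rewrite (@ge0_continuous_FTC2y _ f (fun z => 2 * atan (z / tau)) 0 pi).
  - by rewrite mul0r atan0 mulr0 sube0.
  - by move=> z _; rewrite -lee_fin; exact: f0.
  - exact: continuous_subspaceT.
  - rewrite [X in _ --> X](_ : _ = 2 * (pi / 2)); last by field.
    apply: cvgM; first exact: cvg_cst.
    apply: (@cvg_comp _ _ _ (fun z : R => z / tau) atan _ (pinfty_nbhs R)); last exact: cvgy_atan.
    by apply: gt0_cvgMly => //; rewrite invr_gt0.
  - by move=> z _; apply: ex_derive; exact: dF.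
  - by apply: cvg_at_right_filter; exact: cF.
  - by move=> z _; rewrite derive1E; have /(@derive_val _ _ _ _ _ _ _) := dF z.
by rewrite -EFinD; congr EFin; ring.
Qed.

End line.

(** * Convolution with the kernel majorant *)

Lemma measurable_funV_ge0 {R : realType} d (T : measurableType d) (f : T -> R) :
  (forall x, 0 <= f x) -> measurable_fun setT f ->
  measurable_fun setT (fun x => (f x)^-1).
Proof.
move=> f0 mf; under eq_fun do rewrite -powR_inv1//.
exact: (measurableT_comp (measurable_powR (- 1)) mf).
Qed.

Section sup_norm.
Context {R : realType} {n : nat}.
Implicit Types v : 'rV[R]_n.

Lemma coord_le_norm v i : `|v ord0 i| <= `|v|.
Proof.
rewrite /Num.norm/= mx_normrE.
exact: (le_bigmax _ (fun i : 'I_1 * 'I_n => `|v i.1 i.2|) (ord0, i)).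
Qed.

Lemma norm_eq_coord v : v != 0 -> exists i, `|v| = `|v ord0 i|.
Proof.
rewrite -normr_eq0 => /mx_norm_neq0[[i j] /= h]; exists j.
by rewrite (ord1 i) in h.
Qed.

Lemma measurable_norm_rV : measurable_fun setT (fun v : 'rV[R]_n => `|v|).
Proof.
have -> : (fun v : 'rV[R]_n => `|v|) =
    (fun v => \big[Num.max/0]_i `|v i.1 i.2|).
  by apply/funext => v; rewrite {1}/Num.norm/= mx_normrE.
elim: (index_enum _) => [|i s IH].
  by under eq_fun do rewrite big_nil; exact: measurable_cst.
under eq_fun do rewrite big_cons; apply: measurable_maxr => //.
apply: measurableT_comp => //; under eq_fun do rewrite (ord1 i.1).
exact: measurable_coord.
Qed.

Lemma measurable_rVB d (T : measurableType d) (f g : T -> 'rV[R]_n) :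
  measurable_fun setT f -> measurable_fun setT g ->
  measurable_fun setT (fun t => f t - g t).
Proof.
move=> mf mg; apply: measurable_fun_rV => i; under eq_fun do rewrite !mxE.
by apply: measurable_funB; [exact: (measurableT_comp (measurable_coord i) mf)
  | exact: (measurableT_comp (measurable_coord i) mg)].
Qed.

End sup_norm.

Section majorant.
Context {R : realType} {n : nat}.
Implicit Types x y : 'rV[R]_n.
Local Notation mu := (@lebesgue_measure R).

(* Dominates the kernel at time [tau ^ 4]. At scale 1 even its square does, which
   leaves room for interpolation with a Lipschitz bound. *)
Definition maj (tau : R) (z : 'rV[R]_n) : R := tau ^+ n / Num.max tau `|z| ^+ (2 * n).

Lemma maj_ge0 (tau : R) (z : 'rV[R]_n) : 0 <= tau -> 0 <= maj tau z.
Proof. by move=> h; rewrite divr_ge0 ?exprn_ge0// le_max h. Qed.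

Lemma measurable_maj (tau : R) x : measurable_fun setT (fun y => maj tau (x - y)).
Proof.
apply: measurable_funM => //.
apply: measurable_funV_ge0; first by move=> y; rewrite exprn_ge0// le_max normr_ge0 orbT.
apply: measurable_funX; apply: measurable_maxr => //.
by apply: (measurableT_comp measurable_norm_rV); exact: measurable_rVB.
Qed.

(** With [m = max(tau,|z|)] the majorant is [(tau/m)^n m^(-n)], whose first factor is at most 1. It
    serves where [y] is near the origin and [x - y] or [tau] is not small. *)
Lemma maj_le_inv (tau r : R) (z : 'rV[R]_n) : 0 < tau -> 0 < r -> r <= Num.max tau `|z| ->
  maj tau z <= r ^- n.
Proof.
move=> t0 r0 rm; rewrite /maj mulnC exprM expr2 invfM mulrA.
have m0 : 0 < Num.max tau `|z| by exact: lt_le_trans rm.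
rewrite -[leRHS]mul1r ler_pM//.
- by rewrite divr_ge0 ?exprn_ge0// ltW.
- by rewrite invr_ge0 exprn_ge0// ltW.
- rewrite -expr_div_n; apply: exprn_ile1; first by rewrite divr_ge0 ?ltW.
  by rewrite ler_pdivrMr// mul1r le_max lexx.
- by rewrite lef_pV2 ?posrE ?exprn_gt0// lerXn2r// nnegrE ltW.
Qed.

(** Distributes [(tau/m^2)^n] over the coordinates, using [tau^2 + z_i^2 <= 2 m^2] for
    [m = max(tau,|z|)]. *)
Lemma maj_le_prod (tau : R) (z : 'rV[R]_n) : 0 < tau ->
  maj tau z <= \prod_(i < n) (2 * tau / (tau ^+ 2 + z ord0 i ^+ 2)).
Proof.
move=> t0; rewrite /maj exprM -expr_div_n -[X in _ ^+ X]card_ord -prodr_const.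
have m0 : 0 < Num.max tau `|z| by rewrite lt_max t0.
apply: ler_prod => i _; rewrite divr_ge0 ?exprn_ge0 ?(ltW t0) ?(ltW m0)//=.
have d0 : 0 < tau ^+ 2 + z ord0 i ^+ 2 by rewrite ltr_wpDr ?sqr_ge0 ?exprn_gt0.
rewrite -mulrA mulrCA ler_pM2l// ler_pdivlMr// mulrC ler_pdivrMr ?exprn_gt0//.

rewrite mulr2n mulrDl mul1r lerD//.
  by rewrite lerXn2r ?nnegrE ?(ltW t0) ?(ltW m0)// le_max lexx.
rewrite -real_normK ?num_real// lerXn2r ?nnegrE ?(ltW m0)//.
by rewrite le_max coord_le_norm orbT.
Qed.

(** The integral is split at [|y| = r], half of [max(|x|,tau)]. Inside, the majorant is at most
    [r^(-n)] and the weight has integral of order [r^(n - a)]; outside, the weight is at most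
    [r^(-a)] and the majorant has bounded mass. Both parts are of order [r^(-a)]. *)
Lemma conv_maj_le (a : R) : 0 <= a < n%:R -> exists A : R, 0 < A /\
  forall (tau sigma : R) x, 0 < tau -> 0 < sigma ->
    (\int[lebesgue_rV R n]_y (maj tau (x - y) * Num.max `|y| sigma `^ (- a))%:E
     <= (A * Num.max `|x| tau `^ (- a))%:E)%E.
Proof.
move=> /andP[a0 an].
have n0 : (0 : R) < n%:R by exact: le_lt_trans an.
(* Since [|y_i| <= |y|], the weight is at most the product over [i] of [max(|y_i|,sigma)^(-b)], and
   [b < 1] makes each factor integrable at 0 uniformly in [sigma]. *)
pose b := a / n%:R.
have b0 : 0 <= b by rewrite divr_ge0.
have b1 : 0 < 1 - b by rewrite subr_gt0 ltr_pdivrMr// mul1r.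
have nb : a = b * n%:R by rewrite /b divfK// gt_eqF.
(* The two summands are the inner and the outer part; [2^a] turns [r^(-a)] back into
   [max(|x|,tau)^(-a)]. *)
exists (2 `^ a * ((2 / (1 - b)) ^+ n + (2 * pi) ^+ n)); split.
  by rewrite mulr_gt0 ?powR_gt0// addr_gt0// exprn_gt0 ?divr_gt0// mulr_gt0// pi_gt0.
move=> tau sigma x t0 s0.
pose r : R := Num.max `|x| tau / 2.
have m0 : 0 < Num.max `|x| tau by rewrite lt_max t0 orbT.
have r0 : 0 < r by rewrite divr_gt0.
pose q (z : R) := Num.max `|z| sigma `^ (- b).
pose g1 (i : 'I_n) (z : R) := q z * \1_(`]-r, r[%classic) z.
pose g2 (i : 'I_n) (z : R) := 2 * tau / (tau ^+ 2 + (x ord0 i - z) ^+ 2).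
have mx0 (z : R) : 0 <= Num.max z sigma by rewrite le_max (ltW s0) orbT.
have mq : measurable_fun setT q.
  apply: (measurableT_comp (measurable_powR (- b))).
  by apply: measurable_maxr => //; exact: measurableT_comp.
have mg1 i : measurable_fun setT (g1 i).
  by apply: measurable_funM => //; exact: measurable_indic.
have mg2 i : measurable_fun setT (g2 i).
  apply: measurable_funM => //; apply: measurable_funV_ge0.
    by move=> z; rewrite addr_ge0 ?sqr_ge0.
  apply: measurable_funD => //; apply: measurable_funX.
  exact: measurable_funB.
have g10 i z : 0 <= g1 i z by rewrite mulr_ge0 ?powR_ge0.
have g20 i z : 0 <= g2 i z.
  by rewrite divr_ge0 ?mulr_ge0 ?addr_ge0 ?sqr_ge0// ltW.
have Ig1 i : (\int[mu]_z (g1 i z)%:E <= (2 / (1 - b) * r `^ (1 - b))%:E)%E.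
  rewrite ge0_integral_even; last 3 first.
  - exact/measurable_EFinP.
  - by move=> z; rewrite lee_fin.
  - move=> z; rewrite /g1 /q normrN !indicE; congr (_ * _)%:E.
    suff -> : (- z \in `]-r, r[%classic) = (z \in `]-r, r[%classic) by [].
    by rewrite !mem_setE !in_itv/= ltrN2 ltrNl andbC.
  suff : (\int[mu]_(z in `[0%R, +oo[) (g1 i z)%:E <= ((1 - b)^-1 * r `^ (1 - b))%:E)%E.
    move=> h; apply: le_trans (leeD h h) _; rewrite -EFinD lee_fin.
    by rewrite -mulrDl mulr_natl mulr2n.
  have mg1E : measurable_fun setT (fun z => (g1 i z)%:E) by exact/measurable_EFinP.
  have mpE : measurable_fun setT (fun z : R => (z `^ (1 - b - 1))%:E).
    by apply/measurable_EFinP; exact: measurable_powR.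
  rewrite -integral_itv_obnd_cbnd; last exact: measurable_funTS mg1E.
  apply: le_trans (_ : _ <= \int[mu]_(z in `]0%R, r[) (z `^ ((1 - b) - 1))%:E)%E _; last first.
    by apply: le_trans (ge0_integral_powR_le b1 r0) _; rewrite mulrC.
  rewrite [leRHS]integral_mkcond [leLHS]integral_mkcond.
  apply: ge0_le_integral => //.
  - by move=> z _; rewrite erestrict_ge0// => ? _; rewrite lee_fin.
  - apply/(measurable_restrictT _ _).1 => //.
    exact: measurable_funTS mg1E.
  - apply/(measurable_restrictT _ _).1 => //.
    exact: measurable_funTS mpE.
  - move=> z _; rewrite /patch; case: ifPn; rewrite mem_setE in_itv/= andbT => z0; last first.
      by case: ifPn => // _; rewrite lee_fin powR_ge0.
    case: ifPn; rewrite mem_setE in_itv/= z0/= => zr.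
      rewrite lee_fin /g1 indicE mem_set/= ?in_itv/= ?zr ?andbT; last first.
        by rewrite (lt_trans _ z0)// oppr_lt0.
      rewrite mulr1 /q (_ : 1 - b - 1 = - b); last by ring.
      rewrite !powRN lef_pV2 ?posrE ?powR_gt0//; last by rewrite lt_max normr_gt0 gt_eqF.
      by rewrite ge0_ler_powR ?nnegrE ?(ltW z0)// le_max ?normr_ge0// (ger0_norm (ltW z0)) lexx.
    rewrite lee_fin /g1 indicE memNset/= ?mulr0// in_itv/=.
    by move=> /andP[_ h]; move: zr; rewrite h.
have Ig2 i : (\int[mu]_z (g2 i z)%:E <= (2 * pi)%:E)%E by rewrite integral_cauchy.
have mprod (g : 'I_n -> R -> R) : (forall i, measurable_fun setT (g i)) ->
   measurable_fun setT (fun v : 'rV[R]_n => (\prod_(i < n) g i (v ord0 i))%:E).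
  move=> mk; apply/measurable_EFinP; apply: measurable_prod => i _.
  by apply: measurableT_comp => //; exact: measurable_coord.
apply: le_trans (_ : _ <= \int[lebesgue_rV R n]_y
   ((r ^- n)%:E * (\prod_(i < n) g1 i (y ord0 i))%:E +
    (r `^ (- a))%:E * (\prod_(i < n) g2 i (y ord0 i))%:E))%E _.
  apply: ge0_le_integral => //.
  - by move=> y _; rewrite lee_fin mulr_ge0 ?powR_ge0// maj_ge0// ltW.
  - apply/measurable_EFinP/measurable_funM; first exact: measurable_maj.
    apply: (measurableT_comp (measurable_powR (- a))).
    by apply: measurable_maxr => //; exact: measurable_norm_rV.
  - apply: emeasurable_funD; apply: measurable_funeM; exact: mprod.
  - move=> y _; rewrite -!EFinM -EFinD lee_fin.
    have p1 : 0 <= \prod_(i < n) g1 i (y ord0 i) by exact: prodr_ge0.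
    have p2 : 0 <= \prod_(i < n) g2 i (y ord0 i) by exact: prodr_ge0.
    have [yr|ry] := ltP `|y| r.
      rewrite -[leLHS]addr0 lerD//; last by rewrite mulr_ge0// powR_ge0.
      apply: ler_pM.
      + by rewrite maj_ge0// ltW.
      + exact: powR_ge0.
      + apply: maj_le_inv => //.
        (* Either [r = tau / 2], or [r = |x| / 2] and [|x - y| >= |x| - |y| >= r]. *)
        have [xt|tx] := leP `|x| tau.
          by rewrite le_max /r (max_idPr xt) ler_pdivrMr// ler_peMr ?(ltW t0)// ler1n.
        rewrite le_max; apply/orP; right.
        have := lerB_dist x y; apply: le_trans; rewrite lerBrDr.
        apply: le_trans (lerD (lexx _) (ltW yr)) _.
        by rewrite /r (max_idPl (ltW tx)) -splitr.
      + rewrite nb -mulNr powRrM powR_mulrn ?powR_ge0//.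
        rewrite -[X in _ ^+ X]card_ord -prodr_const; apply: ler_prod => i _.
        have yi : `|y ord0 i| < r by exact: le_lt_trans (coord_le_norm _ _) yr.
        rewrite powR_ge0/= /g1 indicE mem_set/= ?mulr1; last first.
          by rewrite in_itv/= -ltr_norml.
        rewrite /q !powRN lef_pV2 ?posrE ?powR_gt0 ?lt_max ?s0 ?orbT//.
        rewrite ge0_ler_powR ?nnegrE ?mx0//.
        by rewrite ge_max !le_max coord_le_norm lexx orbT.
    rewrite -[leLHS]add0r lerD//; first by rewrite mulr_ge0// invr_ge0 exprn_ge0 ?ltW.
    rewrite mulrC ler_pM ?powR_ge0 ?maj_ge0 ?(ltW t0)//.
      rewrite !powRN lef_pV2 ?posrE ?powR_gt0 ?lt_max ?s0 ?orbT//.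
      by rewrite ge0_ler_powR ?nnegrE ?mx0 ?(ltW r0)// le_max ry.
    apply: le_trans (maj_le_prod _ t0) _.
    by under eq_bigr do rewrite !mxE.
rewrite ge0_integralD//; last 4 first.
- by move=> y _; rewrite -EFinM lee_fin mulr_ge0// ?prodr_ge0// invr_ge0 exprn_ge0 ?ltW.
- by apply: measurable_funeM; exact: mprod.
- by move=> y _; rewrite -EFinM lee_fin mulr_ge0// ?prodr_ge0// powR_ge0.
- by apply: measurable_funeM; exact: mprod.
rewrite !ge0_integralZl//; last 6 first.
- exact: mprod.
- by move=> y _; rewrite lee_fin prodr_ge0.
- by rewrite lee_fin powR_ge0.
- exact: mprod.
- by move=> y _; rewrite lee_fin prodr_ge0.
- by rewrite lee_fin invr_ge0 exprn_ge0 ?ltW.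
have h1 := ge0_integral_tensor_le mg1 g10 Ig1.
have h2 := ge0_integral_tensor_le mg2 g20 Ig2.
apply: le_trans (_ : _ <= (r ^- n * (2 / (1 - b) * r `^ (1 - b)) ^+ n + r `^ (- a) * (2 * pi) ^+ n)%:E)%E _.
  rewrite EFinD (EFinM (r ^- n)) (EFinM (r `^ (- a))); apply: leeD; apply: lee_pmul => //.
  - by rewrite lee_fin invr_ge0 exprn_ge0 ?(ltW r0).
  - by apply: integral_ge0 => y _; rewrite lee_fin prodr_ge0.
  - by rewrite lee_fin powR_ge0.
  - by apply: integral_ge0 => y _; rewrite lee_fin prodr_ge0.
rewrite lee_fin (exprMn _ (2 / (1 - b))) -(powR_mulrn _ (powR_ge0 _ _)) -powRrM.
have -> : r ^- n * ((2 / (1 - b)) ^+ n * r `^ ((1 - b) * n%:R)) = r `^ (- a) * (2 / (1 - b)) ^+ n.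
  rewrite mulrCA mulrC; congr (_ * _).
  rewrite -powR_invn ?ltW// -powRD ?(gt_eqF r0) ?implybT//; congr (_ `^ _).
  by rewrite nb; ring.
rewrite -mulrDr /r powRM ?(ltW m0) ?invr_ge0//.
rewrite -[X in _ * X `^ (- a)]powR_inv1// -powRrM mulrNN mul1r.
by rewrite le_eqVlt; apply/predU1P; left; ring.
Qed.

(** The limit [sigma -> 0] of [conv_maj_le], whose constant is free of [sigma]: on [|y| > 1/(k+1)]
    the weights with and without [sigma = 1/(k+1)] coincide, and monotone convergence removes the
    truncation. *)
Lemma conv_maj_powR_le (a : R) : 0 < a < n%:R -> exists A : R, 0 < A /\
  forall (tau : R) x, 0 < tau ->
    (\int[lebesgue_rV R n]_y (maj tau (x - y) * `|y| `^ (- a))%:E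
     <= (A * Num.max `|x| tau `^ (- a))%:E)%E.
Proof.
move=> /andP[a0 an]; have [|A [A0 hA]] := @conv_maj_le a; first by rewrite ltW.
exists A; split=> // tau x t0.
pose D (k : nat) : set 'rV[R]_n := [set y | k.+1%:R^-1 < `|y|].
pose g (k : nat) y : \bar R := (maj tau (x - y) * (`|y| `^ (- a) * \1_(D k) y))%:E.
have mD k : measurable (D k).
  rewrite -[D k]setTI; apply: (measurable_fun_ltr _ _) => //.
  exact: measurable_norm_rV.
have mg k : measurable_fun setT (g k).
  apply/measurable_EFinP/measurable_funM; first exact: measurable_maj.
  apply: measurable_funM; last exact: measurable_indic.
  exact: (measurableT_comp (measurable_powR (- a)) measurable_norm_rV).
have g0 k y : (0 <= g k y)%E.
  by rewrite lee_fin mulr_ge0 ?maj_ge0 ?(ltW t0)// mulr_ge0 ?powR_ge0.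
have gle k : (\int[lebesgue_rV R n]_y g k y <= (A * Num.max `|x| tau `^ (- a))%:E)%E.
  have s0 : 0 < k.+1%:R^-1 :> R by rewrite invr_gt0.
  apply: le_trans (hA _ _ x t0 s0); apply: ge0_le_integral => //.
    apply/measurable_EFinP/measurable_funM; first exact: measurable_maj.
    apply: (measurableT_comp (measurable_powR (- a))).
    by apply: measurable_maxr => //; exact: measurable_norm_rV.
  move=> y _; rewrite lee_fin ler_wpM2l ?maj_ge0 ?(ltW t0)//.
  rewrite indicE; case: (boolP (y \in D k)); last by rewrite mulr0 powR_ge0.
  by rewrite inE /D/= mulr1 => h; rewrite (max_idPl (ltW h)).
have ndg y : {homo g^~ y : i j / (i <= j)%N >-> (i <= j)%E}.
  move=> i j ij; rewrite lee_fin ler_wpM2l ?maj_ge0 ?(ltW t0)//.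
  rewrite ler_wpM2l ?powR_ge0// !indicE.
  case: (boolP (y \in D i)) => //; rewrite inE /D/= => h; rewrite mem_set//=.
  by apply: le_lt_trans h; rewrite lef_pV2 ?posrE// ler_nat.
have glim y : limn (g^~ y) = (maj tau (x - y) * `|y| `^ (- a))%:E.
  apply: lim_near_cst => //.
  have [->|y0] := eqVneq y 0.
    by apply: nearW => k; rewrite /g normr0 powR0 ?mul0r ?oppr_eq0 ?gt_eqF.
  rewrite -normr_gt0 in y0.
  exists (Num.bound `|y|^-1) => // k /= hk; rewrite /g indicE mem_set ?mulr1//.
  rewrite /D/= invf_plt ?posrE// (lt_le_trans (archi_boundP _))// ler_nat.
  exact: leq_trans hk _.
under eq_integral do rewrite -glim.
have cv := @cvg_monotone_convergence _ _ _ (lebesgue_rV R n) setT measurableT g mg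
  (fun k y _ => g0 k y) (fun y _ => ndg y).
rewrite -(cvg_lim _ cv)//; apply: lime_le; first by apply/cvg_ex; eexists; exact: cv.
exact: nearW.
Qed.

End majorant.

(** * Finite differences of the quartic exponential *)

Section real_line_estimates.
Context {R : realType}.

Lemma norm_sub_le_derive (f df : R -> R) (a b B : R) :
  (forall x : R, is_derive x 1 f (df x)) ->
  (forall x, `|x - a| <= `|b - a| -> `|df x| <= B) ->
  `|f b - f a| <= B * `|b - a|.
Proof.
move=> fdf dfB.
have cf (u v : R) : {within `[u, v], continuous f}.
  by apply: derivable_within_continuous => x _; exact: ex_derive.
have [ab|/ltW ba] := leP a b.
- have [c] := MVT_segment ab (fun x _ => fdf x) (cf a b).
  rewrite in_itv/= => /andP[ac cb] ->; rewrite normrM ler_wpM2r// dfB//.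
  by rewrite !ger0_norm ?subr_ge0// lerB.
- have [c] := MVT_segment ba (fun x _ => fdf x) (cf b a).
  rewrite in_itv/= => /andP[bc ca] e.
  rewrite distrC e normrM (distrC b) ler_wpM2r// dfB//.
  by rewrite distrC (distrC b) !ger0_norm ?subr_ge0// lerB.
Qed.

Lemma norm_cosB_le (a b : R) : `|cos a - cos b| <= `|a - b|.
Proof.
rewrite -[leRHS]mul1r; apply: (@norm_sub_le_derive _ (fun x => - sin x)) => x _.
by rewrite normrN sin_max.
Qed.

Lemma norm_expRNB_le (a b c : R) : c <= a -> c <= b ->
  `|expR (- a) - expR (- b)| <= `|a - b| * expR (- c).
Proof.
have le (u v : R) : c <= u -> u <= v ->
    `|expR (- u) - expR (- v)| <= `|u - v| * expR (- c).
  move=> cu uv; rewrite distrC ler0_norm ?subr_le0 ?ler_expR ?lerN2//.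
  rewrite ler0_norm ?subr_le0// !opprB.
  have -> : expR (- u) - expR (- v) = (1 - expR (- (v - u))) * expR (- u).
    rewrite mulrBl mul1r -expRD; congr (_ - expR _); ring.
  apply: ler_pM; rewrite ?expR_ge0 ?ler_expR ?lerN2//.
    by rewrite subr_ge0 -expR0 ler_expR oppr_le0 subr_ge0.
  have := expR_ge1Dx (- (v - u)); lra.
move=> ca cb; have [ab|/ltW ba] := leP a b; first exact: le.
by rewrite distrC (distrC a); exact: le.
Qed.

Lemma expR_sqr_decay (d : nat) : exists C : R, 0 < C /\
  forall u : R, 0 <= u -> (1 + u) ^+ d * expR (- u ^+ 2) <= C.
Proof.
(* Comes from [(1+u)^(d+1) <= (d+1)! exp(1+u)] and [1 + u - u^2 <= 2]. *)
exists ((d.+1)`!%:R * expR 2); split; first by rewrite mulr_gt0 ?expR_gt0// ltr0n fact_gt0.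
move=> u u0.
have h1 : (1 + u) ^+ d <= (d.+1)`!%:R * expR (1 + u).
  apply: (@le_trans _ _ ((1 + u) ^+ d.+1)); first by rewrite ler_weXn2l ?lerDl.
  have := expR_ge1Dxn d (addr_ge0 ler01 u0).
  rewrite -(@ler_pM2l _ (d.+1)`!%:R) ?ltr0n ?fact_gt0//; apply: le_trans.
  rewrite mulrDr mulrCA divff ?pnatr_eq0 -?lt0n ?fact_gt0// !mulr1.
  by rewrite ler_wpDl.
apply: le_trans (ler_wpM2r (expR_ge0 _) h1) _.
rewrite -mulrA ler_wpM2l// -expRD ler_expR.
have := sqr_ge0 (u - 2^-1); lra.
Qed.

End real_line_estimates.

Section finite_differences.

(** The sign is that of [f v - f (v + h)] because a translation by half a period negates the cosine:
    each difference then doubles the integral instead of cancelling it. *)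
Fixpoint fdiff (V : zmodType) (K : zmodType) (h : V) (k : nat) (f : V -> K) :
    V -> K :=
  if k is k'.+1 then fdiff h k' (fun v => f v - f (v + h)) else f.

(** The induction replaces the whole tower [D] of successive derivatives by its first difference, so
    the mean value inequality is only used on the top derivative. Each step widens the window by
    [|h|]. *)
Lemma norm_fdiff_le (R : realType) (h : R) (k : nat) (D : nat -> R -> R) (z B : R) :
  (forall i (x : R), is_derive x 1 (D i) (D i.+1 x)) ->
  (forall x, `|x - z| <= k%:R * `|h| -> `|D k x| <= B) ->
  `|fdiff h k (D 0) z| <= `|h| ^+ k * B.
Proof.
elim: k D z B => [|k IH] D z B dD DB.
  by rewrite expr0 mul1r DB// subrr normr0 mul0r.
rewrite /= exprSr -mulrA.
apply: (IH (fun i x => D i x - D i (x + h)) z (`|h| * B)).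
  move=> i x; apply: is_deriveB.
  have h1 : is_derive x (1 : R) (shift h) (1 : R) by exact: is_derive_shift.
  by have := @is_derive1_comp _ (D i) (shift h) x _ _ (dD i (x + h)) h1; rewrite mulr1.
move=> x xz; rewrite distrC.
have xh : x + h - x = h by ring.
have := @norm_sub_le_derive _ _ _ x (x + h) B (dD k).
rewrite xh [B * _]mulrC; apply => y.
move=> yx; apply: DB.
rewrite (_ : y - z = (y - x) + (x - z)); last by ring.
by apply: le_trans (ler_normD _ _) _; rewrite -natr1 mulrDl mul1r addrC lerD.
Qed.

End finite_differences.

Section tame_polynomials.
Context {R : realType}.
Implicit Types P Q : R -> {poly R}.

(* The index [r] stands for the sum of the squares of all frequency variables but
   one, so the bounds have to be uniform in it. *)
Definition tame P := forall j, exists C d, 0 <= C /\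
  forall r z, 0 <= r -> `|(P r)^`(j).[z]| <= C * (1 + (r + z ^+ 2)) ^+ d.

Let base_ge1 (r z : R) : 0 <= r -> 1 <= 1 + (r + z ^+ 2).
Proof. by move=> r0; rewrite lerDl addr_ge0// sqr_ge0. Qed.

Lemma tameD P Q : tame P -> tame Q -> tame (fun r => P r + Q r).
Proof.
move=> tP tQ j; have [C [d [C0 h]]] := tP j; have [C' [d' [C'0 h']]] := tQ j.
exists (C + C'), (maxn d d'); split; first exact: addr_ge0.
move=> r z r0; rewrite derivnD hornerD mulrDl.
apply: le_trans (ler_normD _ _) (lerD _ _).
  by apply: le_trans (h _ _ r0) _; rewrite ler_wpM2l// ler_weXn2l ?base_ge1// leq_maxl.
by apply: le_trans (h' _ _ r0) _; rewrite ler_wpM2l// ler_weXn2l ?base_ge1// leq_maxr.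
Qed.

Lemma tame_deriv P : tame P -> tame (fun r => (P r)^`()).
Proof.
move=> tP j; have [C [d [C0 h]]] := tP j.+1; exists C, d; split=> // r z r0.
by rewrite -derivSn; exact: h.
Qed.

(** The Leibniz rule replaces one factor by its derivative, so the induction on the order of
    differentiation has to range over both factors. *)
Lemma tameM P Q : tame P -> tame Q -> tame (fun r => P r * Q r).
Proof.
move=> + + j; elim: j P Q => [|j IH] P Q tP tQ.
  have [C [d [C0 h]]] := tP 0%N; have [C' [d' [C'0 h']]] := tQ 0%N.
  exists (C * C'), (d + d')%N; split; first exact: mulr_ge0.
  move=> r z r0; rewrite derivn0 hornerM normrM exprD mulrACA.
  by apply: ler_pM => //; [exact: h|exact: h'].
have [C [d [C0 h]]] := IH _ _ (tame_deriv tP) tQ.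
have [C' [d' [C'0 h']]] := IH _ _ tP (tame_deriv tQ).
exists (C + C'), (maxn d d'); split; first exact: addr_ge0.
move=> r z r0; rewrite derivSn derivM derivnD hornerD mulrDl.
apply: le_trans (ler_normD _ _) (lerD _ _).
  by apply: le_trans (h _ _ r0) _; rewrite ler_wpM2l// ler_weXn2l ?base_ge1// leq_maxl.
by apply: le_trans (h' _ _ r0) _; rewrite ler_wpM2l// ler_weXn2l ?base_ge1// leq_maxr.
Qed.

Lemma tameC (c : R) : tame (fun=> c%:P).
Proof.
move=> [|j]; exists `|c|, 0%N; split=> // r z r0; rewrite expr0 mulr1.
  by rewrite derivn0 hornerC.
by rewrite derivnC /= horner0 normr0.
Qed.

Lemma tame_index : tame (fun r => r%:P).
Proof.
move=> [|j]; exists 1, 1%N; split=> // r z r0; rewrite expr1 mul1r.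
  rewrite derivn0 hornerC ger0_norm//; have := sqr_ge0 z; lra.
by rewrite derivnC /= horner0 normr0 (le_trans _ (base_ge1 _ r0)).
Qed.

Lemma tameX : tame (fun=> 'X).
Proof.
move=> [|[|j]]; exists 1, 1%N; split=> // r z r0; rewrite expr1 mul1r.
- rewrite derivn0 hornerX; have := sqr_ge0 (`|z| - 1); rewrite sqrrB1 real_normK ?num_real//.
  by have := normr_ge0 z; nra.
- by rewrite derivn1 derivX hornerC normr1 base_ge1.
- by rewrite !derivSn derivX derivC derivnC; case: j => [|j] /=; rewrite horner0 normr0 (le_trans _ (base_ge1 _ r0)).
Qed.

End tame_polynomials.

Section quartic_exponential.
Context {R : realType}.

Definition quartexp (r z : R) : R := expR (- (r + z ^+ 2) ^+ 2).

(** The [k]-th derivative in [z] of [quartexp r] is this polynomial times [quartexp r]; the factor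
    [-4 (r + z^2) z] is the derivative of the exponent. *)
Fixpoint quartpoly (k : nat) (r : R) : {poly R} :=
  if k is k'.+1 then
    (quartpoly k' r)^`() + quartpoly k' r * ((- 4)%:P * ((r%:P + 'X * 'X) * 'X))
  else 1%:P.

Lemma tame_quartpoly k : tame (quartpoly k).
Proof.
elim: k => [|k IH]; first exact: tameC.
apply: tameD; first exact: tame_deriv.
apply: tameM => //; apply: tameM; first exact: tameC.
apply: tameM; last exact: tameX.
apply: tameD; first exact: tame_index.
by apply: tameM; exact: tameX.
Qed.

Lemma is_derive_quartexp (k : nat) (r z : R) :
  is_derive z 1 (fun z => (quartpoly k r).[z] * quartexp r z)
    ((quartpoly k.+1 r).[z] * quartexp r z).
Proof.
pose q : {poly R} := - ((r%:P + 'X * 'X) * (r%:P + 'X * 'X)).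
have -> : (fun z => (quartpoly k r).[z] * quartexp r z) =
    (fun z => (quartpoly k r).[z] * (expR \o horner q) z).
  apply/funext => x; rewrite /quartexp /= /q !hornerE; congr (_ * expR _); ring.
have h1 := is_derive_poly (quartpoly k r) z.
have h2 := @is_derive1_comp _ expR (horner q) z _ _ (is_derive_expR _) (is_derive_poly q z).
have h3 := is_deriveM h1 h2.
eapply is_derive_eq; first exact: h3.
rewrite /GRing.scale/=.
have -> : quartexp r z = expR q.[z].
  by rewrite /quartexp /q !hornerE; congr expR; ring.
rewrite /q !(derivN, derivD, derivM, derivC, derivX) !hornerE/=; ring.
Qed.

Lemma fdiff_quartexp_le (k m : nat) : exists C : R, 0 < C /\
  forall r z h : R, 0 <= r -> `|h| <= 1 ->
  `|fdiff h k (quartexp r) z| <= C * `|h| ^+ k / (1 + (r + z ^+ 2)) ^+ m.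
Proof.
have [C [d [C0 hC]]] := tame_quartpoly k 0%N.
have [C' [C'0 hC']] := @expR_sqr_decay R (d + m).
(* The derivative is evaluated at some [x] within [k] of [z], and [z^2 <= 2 x^2 + 2 (z - x)^2] gives
   [1 + r + z^2 <= c (1 + r + x^2)]. *)
pose c : R := 2 + 2 * k%:R ^+ 2.
have c0 : 0 < c by rewrite ltr_pwDl// mulr_ge0// sqr_ge0.
(* [C + 1] instead of [C], which may vanish, keeps the constant positive. *)
exists ((C + 1) * C' * c ^+ m); split.
  by rewrite !mulr_gt0 ?exprn_gt0// ltr_wpDl.
move=> r z h r0 h1.
have pos (x : R) : 0 < 1 + (r + x ^+ 2) by rewrite ltr_pwDl// addr_ge0// sqr_ge0.
have -> : fdiff h k (quartexp r) z =
    fdiff h k ((fun i z => (quartpoly i r).[z] * quartexp r z) 0%N) z.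
  by congr fdiff; apply/funext => x /=; rewrite hornerC mul1r.
rewrite -mulrA mulrCA.
apply: (@norm_fdiff_le R h k (fun i z => (quartpoly i r).[z] * quartexp r z)).
  by move=> i x; exact: is_derive_quartexp.
move=> x xz.
have xz' : `|x - z| <= k%:R.
  by apply: le_trans xz _; rewrite ler_piMr.
have zx : 1 + (r + z ^+ 2) <= c * (1 + (r + x ^+ 2)).
  have h2 : (z - x) ^+ 2 <= k%:R ^+ 2.
    by rewrite -[leLHS]real_normK ?num_real// lerXn2r ?nnegrE// distrC.
  have h3 := sqr_ge0 (2 * x - z); have h4 := sqr_ge0 x.
  have h5 : 0 <= k%:R ^+ 2 * r :> R by rewrite mulr_ge0// sqr_ge0.
  have h6 : 0 <= k%:R ^+ 2 * x ^+ 2 :> R by rewrite mulr_ge0// sqr_ge0.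
  rewrite /c; nra.
rewrite normrM [X in _ * X]ger0_norm ?expR_ge0//.
have := hC r x r0; rewrite derivn0 => hCx.
apply: le_trans (ler_wpM2r (expR_ge0 _) hCx) _.
have rx0 : 0 <= r + x ^+ 2 by rewrite addr_ge0// sqr_ge0.
rewrite ler_pdivlMr ?exprn_gt0//.
apply: (@le_trans _ _ (C * (1 + (r + x ^+ 2)) ^+ d * quartexp r x *
    (c * (1 + (r + x ^+ 2))) ^+ m)).
  rewrite ler_wpM2l//; first by rewrite !mulr_ge0 ?expR_ge0 ?exprn_ge0 ?(ltW (pos _)).
  by rewrite lerXn2r// nnegrE ?mulr_ge0 ?ltW.
have -> : C * (1 + (r + x ^+ 2)) ^+ d * quartexp r x * (c * (1 + (r + x ^+ 2))) ^+ m
   = C * ((1 + (r + x ^+ 2)) ^+ (d + m) * quartexp r x) * c ^+ m.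
  by rewrite exprMn exprD; ring.
rewrite ler_wpM2r ?exprn_ge0 ?(ltW c0)// ler_pM//.
- by rewrite mulr_ge0 ?expR_ge0// exprn_ge0// ltW.
- by rewrite lerDl.
- exact: hC'.
Qed.

End quartic_exponential.

(** * Oscillatory integrals *)

Section euclidean.
Context {R : realType} {N : nat}.
Implicit Types x y xi h : 'rV[R]_N.

Lemma dotrr_ge0 x : 0 <= dotr x x.
Proof. by apply: sumr_ge0 => i _; rewrite -expr2 sqr_ge0. Qed.

Lemma enorm_sqr x : enorm x ^+ 2 = dotr x x.
Proof. by rewrite sqr_sqrtr// dotrr_ge0. Qed.

Lemma dotrDr x y h : dotr x (y + h) = dotr x y + dotr x h.
Proof. by rewrite -big_split/=; apply: eq_bigr => i _; rewrite mxE mulrDr. Qed.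

Lemma dotrBl x y h : dotr (x - y) h = dotr x h - dotr y h.
Proof. by rewrite -sumrB; apply: eq_bigr => i _; rewrite !mxE mulrBl. Qed.

Lemma coord_sqr_le_dotr x i : x ord0 i ^+ 2 <= dotr x x.
Proof.
rewrite /dotr (bigD1 i)//= -expr2 lerDl; apply: sumr_ge0 => j _.
by rewrite -expr2 sqr_ge0.
Qed.

Lemma norm_dotr_le x y : `|dotr x y| <= N%:R * `|x| * (1 + dotr y y).
Proof.
apply: le_trans (ler_norm_sum _ _ _) _.
apply: (@le_trans _ _ (\sum_(i < N) `|x| * (1 + dotr y y))).
  apply: ler_sum => i _; rewrite normrM ler_pM// ?coord_le_norm//.
  have := coord_sqr_le_dotr y i; rewrite -real_normK ?num_real//.
  have := sqr_ge0 (`|y ord0 i| - 1); have := normr_ge0 (y ord0 i); nra.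
by rewrite sumr_const card_ord -[leLHS]mulr_natl mulrA.
Qed.

Lemma measurable_dotr d (T : measurableType d) (f g : T -> 'rV[R]_N) :
  measurable_fun setT f -> measurable_fun setT g ->
  measurable_fun setT (fun t => dotr (f t) (g t)).
Proof.
move=> mf mg; apply: measurable_sum => i.
by apply: measurable_funM; [exact: (measurableT_comp (measurable_coord i) mf)
  | exact: (measurableT_comp (measurable_coord i) mg)].
Qed.

End euclidean.

Section weight.
Context {R : realType} {N : nat}.
Implicit Types x xi h : 'rV[R]_N.

(** An integrable weight at the frequency scale [1/tau]. Its product form makes it easy to
    integrate, and it dominates [(1 + tau^2 |xi|^2)^(-N)], the form in which the symbol bounds
    arise. *)
Definition cauchyw (tau : R) xi : R := \prod_(i < N) (1 + (tau * xi ord0 i) ^+ 2)^-1.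

Let den_gt0 (z : R) : 0 < 1 + z ^+ 2.
Proof. by rewrite ltr_pwDl// sqr_ge0. Qed.

Lemma cauchyw_ge0 tau xi : 0 <= cauchyw tau xi.
Proof. by apply: prodr_ge0 => i _; rewrite invr_ge0 ltW. Qed.

Let measurable_factor (tau : R) :
  measurable_fun setT (fun z : R => (1 + (tau * z) ^+ 2)^-1).
Proof.
apply: measurable_funV_ge0; first by move=> z; exact: ltW.
by apply: measurable_funD => //; apply: measurable_funX; exact: measurable_funM.
Qed.

Lemma measurable_cauchyw tau : measurable_fun setT (cauchyw tau).
Proof.
apply: measurable_prod => i _.
exact: (measurableT_comp (measurable_factor tau) (measurable_coord i)).
Qed.

Lemma integral_cauchyw_le tau : 0 < tau ->
  (\int[lebesgue_rV R N]_xi (cauchyw tau xi)%:E <= ((pi / tau) ^+ N)%:E)%E.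
Proof.
move=> t0.
apply: (ge0_integral_tensor_le (g := fun _ z => (1 + (tau * z) ^+ 2)^-1)).
- by move=> _; exact: measurable_factor.
- by move=> _ z; rewrite invr_ge0 ltW.
move=> _; have ti0 : 0 < tau^-1 by rewrite invr_gt0.
have mf : measurable_fun setT
    (fun z : R => (2 * tau^-1 / (tau^-1 ^+ 2 + (0 - z) ^+ 2))%:E).
  apply/measurable_EFinP/measurable_funM => //; apply: measurable_funV_ge0.
    by move=> z; rewrite addr_ge0 ?sqr_ge0.
  apply: measurable_funD => //; apply: measurable_funX.
  exact: measurable_funB.
(* The factor is [1/(2 tau)] times the integrand of [integral_cauchy] at scale [1/tau] and centre 0,
   which yields [pi / tau]. *)
under eq_integral => z _.
  rewrite (_ : (_ + _)^-1 = (2 * tau)^-1 * (2 * tau^-1 / (tau^-1 ^+ 2 + (0 - z) ^+ 2))).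
    rewrite EFinM; over.
  have h1 := den_gt0 (tau * z).
  have h2 : 0 < tau^-1 ^+ 2 + (0 - z) ^+ 2 by rewrite ltr_pwDl ?sqr_ge0// exprn_gt0.
  have h3 : 1 + (tau * z) ^+ 2 = tau ^+ 2 * (tau^-1 ^+ 2 + (0 - z) ^+ 2).
    by rewrite sub0r sqrrN mulrDr -exprMn mulfV ?gt_eqF// expr1n exprMn.
  rewrite h3; move: (tau^-1 ^+ 2 + (0 - z) ^+ 2) h2 => X h2; field.
  by rewrite (gt_eqF t0) (gt_eqF h2).
rewrite ge0_integralZl//.
- by rewrite integral_cauchy// -EFinM lee_fin le_eqVlt; apply/predU1P; left; field; rewrite gt_eqF.
- by move=> z _; rewrite lee_fin divr_ge0 ?mulr_ge0 ?addr_ge0 ?sqr_ge0// ltW.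
- by rewrite lee_fin invr_ge0 mulr_ge0// ltW.
Qed.

Lemma cauchyw_ge tau xi : ((1 + tau ^+ 2 * dotr xi xi) ^+ N)^-1 <= cauchyw tau xi.
Proof.
rewrite -exprVn -[X in _ ^+ X]card_ord -prodr_const; apply: ler_prod => i _.
have h : 0 <= tau ^+ 2 * dotr xi xi by rewrite mulr_ge0 ?sqr_ge0 ?dotrr_ge0.
rewrite invr_ge0 addr_ge0//= lef_pV2 ?posrE//; last by rewrite ltr_pwDl.
by rewrite lerD2l exprMn ler_wpM2l ?sqr_ge0 ?coord_sqr_le_dotr.
Qed.

Lemma integrable_le_cauchyw tau (C : R) (g : 'rV[R]_N -> R) : 0 < tau -> 0 <= C ->
  measurable_fun setT g -> (forall xi, `|g xi| <= C * cauchyw tau xi) ->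
  (\int[lebesgue_rV R N]_xi `|g xi|%:E <= (C * (pi / tau) ^+ N)%:E)%E /\
  (lebesgue_rV R N).-integrable setT (EFin \o g).
Proof.
move=> t0 C0 mg gC.
have le : (\int[lebesgue_rV R N]_xi `|g xi|%:E <= (C * (pi / tau) ^+ N)%:E)%E.
  apply: (@le_trans _ _ (\int[lebesgue_rV R N]_xi (C%:E * (cauchyw tau xi)%:E))%E).
    apply: ge0_le_integral => //.
    - by apply/measurable_EFinP; exact: measurableT_comp.
    - by apply: measurable_funeM; apply/measurable_EFinP; exact: measurable_cauchyw.
    - by move=> xi _; rewrite -EFinM lee_fin.
  rewrite ge0_integralZl//.
  - by rewrite EFinM lee_wpmul2l// integral_cauchyw_le.
  - by apply/measurable_EFinP; exact: measurable_cauchyw.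
  - by move=> xi _; rewrite lee_fin cauchyw_ge0.
split=> //; apply/integrableP; split; first exact/measurable_EFinP.
by apply: le_lt_trans le _; rewrite ltry.
Qed.

End weight.

Section oscillatory_integral.
Context {R : realType} {N : nat}.
Implicit Types x xi h : 'rV[R]_N.

Lemma measurable_cos_dotr x : measurable_fun setT (fun xi => cos (dotr x xi)).
Proof.
apply: (measurableT_comp (f := @cos R)).
  by apply: continuous_measurable_fun; exact: continuous_cos.
exact: measurable_dotr.
Qed.

Lemma integrable_cos_dotr x (g : 'rV[R]_N -> R) :
  (lebesgue_rV R N).-integrable setT (EFin \o g) ->
  (lebesgue_rV R N).-integrable setT (EFin \o (fun xi => cos (dotr x xi) * g xi)).
Proof.
move=> ig; have /measurable_EFinP mg := measurable_int _ ig.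
apply: le_integrable ig => //.
  by apply/measurable_EFinP/measurable_funM => //; exact: measurable_cos_dotr.
by move=> xi _ /=; rewrite lee_fin normrM ler_piMl// cos_max.
Qed.

Lemma integrable_shift h (g : 'rV[R]_N -> R) :
  (lebesgue_rV R N).-integrable setT (EFin \o g) ->
  (lebesgue_rV R N).-integrable setT (EFin \o (fun xi => g (xi + h))).
Proof.
move=> /integrableP[mg ig]; apply/integrableP; split.
  by apply: (measurableT_comp mg); exact: measurable_shift_rV.
have := ge0_integral_shift h (f := fun xi => `|(EFin \o g) xi|%E).
by move=> -> //; exact: measurableT_comp.
Qed.

(** Translation invariance moves the shift of [g] onto the cosine, where it is a change of sign; the
    two terms of each difference then contribute equally. *)
Lemma integral_cos_fdiff x h k (g : 'rV[R]_N -> R) : dotr x h = pi ->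
  (lebesgue_rV R N).-integrable setT (EFin \o g) ->
  2 ^+ k * (\int[lebesgue_rV R N]_xi (cos (dotr x xi) * g xi)) =
  \int[lebesgue_rV R N]_xi (cos (dotr x xi) * fdiff h k g xi).
Proof.
move=> xh; elim: k g => [|k IH] g ig; first by rewrite mul1r.
have igh := integrable_shift h ig.
rewrite /= -IH; last first.
  by have := integrableB measurableT ig igh; apply: eq_integrable.
rewrite exprSr -mulrA; congr (_ * _).
under [RHS]eq_Rintegral do rewrite mulrBr.
rewrite RintegralB//; [|exact: integrable_cos_dotr|exact: integrable_cos_dotr].
have -> : \int[lebesgue_rV R N]_xi (cos (dotr x xi) * g (xi + h)) =
    - (\int[lebesgue_rV R N]_xi (cos (dotr x xi) * g xi)); last first.
  by rewrite opprK mulr_natl mulr2n.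
have /measurable_EFinP mg := measurable_int _ (integrable_cos_dotr x ig).
rewrite -(Rintegral_shift h mg) -mulN1r -RintegralZl//; last first.
  exact/(integrable_shift h (g := fun xi => cos (dotr x xi) * g xi))/integrable_cos_dotr.
apply: eq_Rintegral => xi _; by rewrite dotrDr xh cosDpi; ring.
Qed.

End oscillatory_integral.

(** * The biharmonic heat kernel *)

Section kernel.
Context {R : realType} {N : nat}.
Implicit Types x xi h : 'rV[R]_N.

Definition fourier_symbol (t : R) xi : R := expR (- (t * dotr xi xi ^+ 2)).

Lemma biharmonic_kernelE x t : biharmonic_kernel x t =
  (2 * pi) ^- N * \int[lebesgue_rV R N]_xi (cos (dotr x xi) * fourier_symbol t xi).
Proof.
rewrite /biharmonic_kernel /integralC /= [X in _ - X]mul0r [LHS]subr0; congr (_ * _).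
apply: eq_Rintegral => xi _ /=.
rewrite mulrC /fourier_symbol -enorm_sqr -exprM; congr (cos _ * expR _); ring.
Qed.

Lemma measurable_fourier_symbol t : measurable_fun setT (fourier_symbol t).
Proof.
apply: (measurableT_comp (f := @expR R)) => //.
apply: measurableT_comp => //; apply: measurable_funM => //.
by apply: measurable_funX; exact: measurable_dotr.
Qed.

Lemma measurable_biharmonic_kernel :
  measurable_fun setT (fun z : 'rV[R]_N * R => biharmonic_kernel z.1 z.2).
Proof.
under eq_fun do rewrite biharmonic_kernelE.
apply: measurable_funM => //.
apply: (@measurable_Rintegral R _ _ ('rV[R]_N * R)%type 'rV[R]_N (lebesgue_rV R N)
  (fun z => cos (dotr z.1.1 z.2) * fourier_symbol z.1.2 z.2)).
have m11 : measurable_fun setT (fun z : ('rV[R]_N * R) * 'rV[R]_N => z.1.1).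
  by apply: measurableT_comp.
apply: measurable_funM.
  apply: (measurableT_comp (f := @cos R)).
    by apply: continuous_measurable_fun; exact: continuous_cos.
  exact: measurable_dotr.
apply: (measurableT_comp (f := @expR R)) => //.
apply: measurableT_comp => //; apply: measurable_funM.
  by apply: measurableT_comp.
by apply: measurable_funX; exact: measurable_dotr.
Qed.

Let coord_split (xi : 'rV[R]_N) j :
  dotr xi xi = (\sum_(i < N | i != j) xi ord0 i ^+ 2) + xi ord0 j ^+ 2.
Proof. by rewrite addrC /dotr (bigD1 j). Qed.

(** Reduces differences along a coordinate axis to differences in one variable: [r] collects what
    the translation leaves fixed, [l] the coordinate that it moves. *)
Lemma fdiff_comp (U V : zmodType) (T : Type) (h : U) (th : V) k
    (f : U -> R) (E : T -> V -> R) (r : U -> T) (l : U -> V) :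
  (forall u, f u = E (r u) (l u)) -> (forall u, r (u + h) = r u) ->
  (forall u, l (u + h) = l u + th) ->
  forall u, fdiff h k f u = fdiff th k (E (r u)) (l u).
Proof.
move=> fE rh lh; elim: k f E fE => [|k IH] f E fE u; first exact: fE.
rewrite /= (IH _ (fun t v => E t v - E t (v + th)))// => w.
by rewrite !fE rh lh.
Qed.

(** Along the axis [j] the symbol at time [tau^4] is [quartexp] of [tau xi_j], with the other
    coordinates in the index. The bound on [quartexp] being uniform in the index, the constant
    depends on neither [tau] nor [j]. *)
Lemma norm_fdiff_fourier_symbol_le k : exists C : R, 0 < C /\
  forall (tau : R) j (a : R), 0 < tau -> `|tau * a| <= 1 -> forall xi,
  `|fdiff (a *: delta_mx ord0 j) k (fourier_symbol (tau ^+ 4)) xi| <=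
    C * `|tau * a| ^+ k * cauchyw tau xi.
Proof.
have [C [C0 hC]] := @fdiff_quartexp_le R k N.
exists C; split=> // tau j a t0 ha xi.
pose r (v : 'rV[R]_N) := tau ^+ 2 * \sum_(i < N | i != j) v ord0 i ^+ 2.
have r0 v : 0 <= r v by rewrite mulr_ge0 ?sqr_ge0// sumr_ge0// => i _; exact: sqr_ge0.
have rE v : r v + (tau * v ord0 j) ^+ 2 = tau ^+ 2 * dotr v v.
  by rewrite (coord_split v j) mulrDr exprMn.
rewrite (@fdiff_comp _ _ _ _ (tau * a) _ _ quartexp r (fun v => tau * v ord0 j)).
- apply: le_trans (hC _ _ _ (r0 _) ha) _; rewrite rE.
  by rewrite ler_wpM2l ?cauchyw_ge// mulr_ge0 ?exprn_ge0// ltW.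
- move=> v; rewrite /fourier_symbol /quartexp rE; congr expR.
  by rewrite exprMn -exprM.
- move=> v; congr (_ * _); apply: eq_bigr => i ij.
  by rewrite !mxE eqxx (negbTE ij) mulr0 addr0.
- by move=> v; rewrite !mxE !eqxx mulr1 mulrDr.
Qed.

Lemma norm_integral_cos_le (tau C : R) x (g : 'rV[R]_N -> R) : 0 < tau -> 0 <= C ->
  measurable_fun setT g -> (forall xi, `|g xi| <= C * cauchyw tau xi) ->
  `|\int[lebesgue_rV R N]_xi (cos (dotr x xi) * g xi)| <= C * (pi / tau) ^+ N.
Proof.
move=> t0 C0 mg gC.
have mcg : measurable_fun setT (fun xi => cos (dotr x xi) * g xi).
  by apply: measurable_funM => //; exact: measurable_cos_dotr.
have cgC xi : `|cos (dotr x xi) * g xi| <= C * cauchyw tau xi.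
  by apply: le_trans (gC xi); rewrite normrM ler_piMl// cos_max.
have [le ig] := integrable_le_cauchyw t0 C0 mcg cgC.
rewrite -lee_fin EFin_normr_Rintegral//.
by apply: (le_trans (le_abse_integral (lebesgue_rV R N) measurableT _)); [exact/measurable_EFinP|exact: le].
Qed.

Lemma fourier_symbol_le m : exists C : R, 0 < C /\ forall (tau : R) xi, 0 < tau ->
  (1 + tau ^+ 2 * dotr xi xi) ^+ m * fourier_symbol (tau ^+ 4) xi <= C * cauchyw tau xi.
Proof.
have [C [C0 hC]] := @expR_sqr_decay R (m + N).
exists C; split=> // tau xi t0.
have u0 : 0 <= tau ^+ 2 * dotr xi xi by rewrite mulr_ge0 ?sqr_ge0 ?dotrr_ge0.
apply: le_trans (_ : C / (1 + tau ^+ 2 * dotr xi xi) ^+ N <= _); last first.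
  by rewrite ler_wpM2l ?cauchyw_ge// ltW.
rewrite ler_pdivlMr ?exprn_gt0 ?ltr_pwDl// mulrAC -exprD.
by have := hC _ u0; rewrite /fourier_symbol exprMn -exprM.
Qed.

Lemma integrable_fourier_symbol (tau : R) : 0 < tau ->
  (lebesgue_rV R N).-integrable setT (EFin \o fourier_symbol (tau ^+ 4)).
Proof.
move=> t0; have [C [C0 hC]] := fourier_symbol_le 0.
have [] // := @integrable_le_cauchyw R N tau C (fourier_symbol (tau ^+ 4)) t0 (ltW C0).
  exact: measurable_fourier_symbol.
by move=> xi; have := hC tau xi t0; rewrite mul1r ger0_norm// expR_ge0.
Qed.

Lemma measurable_fdiff h k (g : 'rV[R]_N -> R) : measurable_fun setT g ->
  measurable_fun setT (fdiff h k g).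
Proof.
elim: k g => [//|k IH] g mg /=; apply: IH; apply: measurable_funB => //.
by apply: (measurableT_comp mg); exact: measurable_shift_rV.
Qed.

(* Translating the frequency by [h] with [x . h = pi] changes the sign of
   [cos (x . xi)], so that the [k]-th difference of the symbol gains
   [|h|^k = (pi / |x|)^k] without any integration by parts. *)
Lemma biharmonic_kernel_decay k : exists C : R, 0 < C /\
  forall (tau : R) x, 0 < tau ->
  `|biharmonic_kernel x (tau ^+ 4)| <= C * tau ^- N * (tau / Num.max tau `|x|) ^+ k.
Proof.
have [C1 [C10 h1]] := norm_fdiff_fourier_symbol_le k.
have [C2 [C20 h2]] := fourier_symbol_le 0.
have pi0 : 0 < pi :> R by exact: pi_gt0.
have pi20 : 0 < 2 * pi :> R by lra.
have pi1 : 1 <= pi :> R by have := @pi_ge2 R; lra.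
exists ((2 * pi) ^- N * ((C1 + C2) * pi ^+ k * pi ^+ N)); split.
  apply: mulr_gt0; first by rewrite invr_gt0 exprn_gt0// pi20.
  by apply: mulr_gt0; rewrite ?exprn_gt0//; apply: mulr_gt0; rewrite ?exprn_gt0// addr_gt0.
move=> tau x t0; rewrite biharmonic_kernelE normrM ger0_norm; last first.
  by rewrite invr_ge0 exprn_ge0// mulr_ge0// ltW.
rewrite -!mulrA ler_wpM2l ?invr_ge0 ?exprn_ge0 ?mulr_ge0 ?(ltW pi0)//.
have m0 : 0 < Num.max tau `|x| by rewrite lt_max t0.
have q0 : 0 <= tau / Num.max tau `|x| by rewrite divr_ge0 ?ltW.
have [xt|tx] := ltP `|x| (pi * tau).
  have := @norm_integral_cos_le tau C2 x (fourier_symbol (tau ^+ 4)) t0 (ltW C20)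
    (measurable_fourier_symbol _).
  move=> /(_ _)/le_trans; apply.
    by move=> xi; have := h2 tau xi t0; rewrite mul1r ger0_norm// expR_ge0.
  rewrite expr_div_n.
  have h : 1 <= pi ^+ k * (tau / Num.max tau `|x|) ^+ k.
    rewrite -exprMn exprn_ege1// mulrA ler_pdivlMr// mul1r ge_max (ltW xt) andbT.
    by rewrite ler_peMl// ltW.
  set p := pi ^+ k in h *; set q := (tau / _) ^+ k in h *.
  have s0 : 0 <= pi ^+ N * tau ^- N.
    by rewrite mulr_ge0 ?invr_ge0 ?exprn_ge0 ?(ltW t0) ?(ltW pi0).
  apply: le_trans (_ : C2 * (p * q) * (pi ^+ N * tau ^- N) <= _).
    by rewrite ler_wpM2r// ler_peMr// ltW.
  rewrite [leRHS](_ : _ = (C1 + C2) * (p * q) * (pi ^+ N * tau ^- N)); last by ring.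
  rewrite ler_wpM2r// ler_wpM2r ?(le_trans _ h)//.
  by rewrite lerDr ltW.
have x0 : 0 < `|x| by apply: lt_le_trans tx; rewrite mulr_gt0.
have [j xj] : exists j, `|x| = `|x ord0 j| by apply: norm_eq_coord; rewrite -normr_gt0.
have xj0 : x ord0 j != 0 by rewrite -normr_gt0 -xj.
(* The shift points along a coordinate where the sup norm of [x] is attained, so [|a| = pi / |x|].
   Then [tau |a| <= 1] says [pi tau <= |x|], the present case. *)
pose a := pi / x ord0 j.
have ta : `|tau * a| = pi * (tau / Num.max tau `|x|).
  have -> : Num.max tau `|x| = `|x|.
    by apply/max_idPr; apply: le_trans tx; rewrite ler_peMl// ltW.
  rewrite /a normrM normf_div -xj !ger0_norm ?(ltW t0) ?(ltW pi0)//.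
  by rewrite mulrCA.
have ta1 : `|tau * a| <= 1.
  rewrite ta mulrA ler_pdivrMr// mul1r le_max tx orbT//.
have xh : dotr x (a *: delta_mx ord0 j) = pi.
  rewrite /dotr (bigD1 j)//= big1 ?addr0.
    by rewrite !mxE !eqxx mulr1 /a mulrC divfK.
  by move=> i ij; rewrite !mxE eqxx (negbTE ij) !mulr0.
have := integral_cos_fdiff k xh (integrable_fourier_symbol t0).
set I := \int[_]_xi (cos (dotr x xi) * fourier_symbol _ xi) => e.
have kI : `|I| <= 2 ^+ k * `|I| by rewrite ler_peMl// exprn_ege1// ler1n.
apply: le_trans kI _.
rewrite -[X in X * _](@ger0_norm _ (2 ^+ k)) ?exprn_ge0// -normrM e.
have := @norm_integral_cos_le tau (C1 * `|tau * a| ^+ k) x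
   (fdiff (a *: delta_mx ord0 j) k (fourier_symbol (tau ^+ 4))) t0.
move=> /(_ (mulr_ge0 (ltW C10) (exprn_ge0 _ (normr_ge0 _))))/(_ _ _)/le_trans; apply.
- by apply: measurable_fdiff; exact: measurable_fourier_symbol.
- exact: h1.
rewrite ta exprMn (expr_div_n pi).
set p := pi ^+ k; set q := (tau / _) ^+ k.
have pq0 : 0 <= p * q by rewrite mulr_ge0 ?exprn_ge0 ?(ltW pi0).
have s0 : 0 <= pi ^+ N * tau ^- N.
  by rewrite mulr_ge0 ?invr_ge0 ?exprn_ge0 ?(ltW t0) ?(ltW pi0).
rewrite [leRHS](_ : _ = (C1 + C2) * (p * q) * (pi ^+ N * tau ^- N)); last by ring.
by rewrite ler_wpM2r// ler_wpM2r// lerDl ltW.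
Qed.

(** The cosine and the exponential are varied one after the other. This costs factors of order
    [1 + |xi|^2] and [|xi|^4], both absorbed by [(1 + tau^2 |xi|^2)^2]; the symbols are compared
    with the one at the earlier time [tau^4]. *)
Lemma norm_symbolB_le (tau s t : R) x y xi : 0 < tau -> tau ^+ 4 <= s -> tau ^+ 4 <= t ->
  `|cos (dotr x xi) * fourier_symbol s xi - cos (dotr y xi) * fourier_symbol t xi| <=
  (`|x - y| + `|s - t|) * ((N%:R * (1 + tau ^- 2) + tau ^- 4) *
    ((1 + tau ^+ 2 * dotr xi xi) ^+ 2 * fourier_symbol (tau ^+ 4) xi)).
Proof.
move=> t0 ts tt; set d := dotr xi xi; set E := fourier_symbol (tau ^+ 4) xi.
have d0 : 0 <= d by exact: dotrr_ge0.
have E0 : 0 <= E by exact: expR_ge0.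
have -> : cos (dotr x xi) * fourier_symbol s xi - cos (dotr y xi) * fourier_symbol t xi =
  (cos (dotr x xi) - cos (dotr y xi)) * fourier_symbol s xi +
  cos (dotr y xi) * (fourier_symbol s xi - fourier_symbol t xi) by ring.
have u1 : 1 <= 1 + tau ^+ 2 * d by rewrite lerDl mulr_ge0// sqr_ge0.
have ti2 : 0 < tau ^- 2 by rewrite invr_gt0 exprn_gt0.
have ti4 : 0 < tau ^- 4 by rewrite invr_gt0 exprn_gt0.
have dE : d = tau ^- 2 * (tau ^+ 2 * d) by rewrite mulKf// gt_eqF ?exprn_gt0.
have hx : `|(cos (dotr x xi) - cos (dotr y xi)) * fourier_symbol s xi| <=
    `|x - y| * (N%:R * (1 + tau ^- 2) * ((1 + tau ^+ 2 * d) ^+ 2 * E)).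
  rewrite normrM (ger0_norm (expR_ge0 _)).
  have sE : fourier_symbol s xi <= E.
    by rewrite ler_expR lerN2 ler_wpM2r// sqr_ge0.
  apply: le_trans (ler_pM _ _ (norm_cosB_le _ _) sE) _ => //; first exact: expR_ge0.
  rewrite -dotrBl; apply: le_trans (ler_wpM2r E0 (norm_dotr_le _ _)) _.
  rewrite -/d [leLHS](_ : _ = `|x - y| * (N%:R * ((1 + d) * E))); last by ring.
  rewrite ler_wpM2l// -[leRHS]mulrA ler_wpM2l// [leRHS]mulrA ler_wpM2r//.
  apply: (@le_trans _ _ ((1 + tau ^- 2) * (1 + tau ^+ 2 * d))).
    rewrite {1}dE; move: (tau ^+ 2 * d) u1 => u u1; nra.
  by rewrite ler_wpM2l ?addr_ge0 ?(ltW ti2)// expr2 ler_peMr// (le_trans ler01).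
have ht : `|cos (dotr y xi) * (fourier_symbol s xi - fourier_symbol t xi)| <=
    `|s - t| * (tau ^- 4 * ((1 + tau ^+ 2 * d) ^+ 2 * E)).
  rewrite normrM; apply: le_trans (ler_wpM2r (normr_ge0 _) (cos_max _)) _.
  rewrite mul1r.
  have h := @norm_expRNB_le R (s * d ^+ 2) (t * d ^+ 2) (tau ^+ 4 * d ^+ 2).
  apply: le_trans (h _ _) _; rewrite ?ler_wpM2r ?sqr_ge0//.
  rewrite -mulrBl normrM -mulrA ler_wpM2l// -/(fourier_symbol (tau ^+ 4) xi) -/E (ger0_norm (sqr_ge0 _)) mulrA ler_wpM2r//.
  have -> : d ^+ 2 = tau ^- 4 * (tau ^+ 2 * d) ^+ 2 by field; rewrite gt_eqF.
  rewrite ler_wpM2l ?(ltW ti4)//.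
  have u0 := mulr_ge0 (sqr_ge0 tau) d0.
  by rewrite lerXn2r ?nnegrE ?addr_ge0// lerDr.
apply: le_trans (ler_normD _ _) (le_trans (lerD hx ht) _).
rewrite -/d -/E.
have k0 : 0 <= (1 + tau ^+ 2 * d) ^+ 2 * E by rewrite mulr_ge0 ?sqr_ge0.
set K := _ * E in k0 *.
have a0 : 0 <= N%:R * (1 + tau ^- 2) :> R by rewrite mulr_ge0 ?addr_ge0 ?(ltW ti2).
have n1 := normr_ge0 (x - y); have n2 := normr_ge0 (s - t).
set a := N%:R * _ in a0 *; set b := tau ^- 4 in ti4 *.
rewrite -subr_ge0 (_ : _ - _ = `|x - y| * (b * K) + `|s - t| * (a * K)); last by ring.
by rewrite addr_ge0// mulr_ge0// mulr_ge0// ltW.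
Qed.

Lemma biharmonic_kernel_lipschitz (tau : R) : 0 < tau -> exists L : R, 0 < L /\
  forall x y s t, tau ^+ 4 <= s -> tau ^+ 4 <= t ->
  `|biharmonic_kernel x s - biharmonic_kernel y t| <= L * (`|x - y| + `|s - t|).
Proof.
move=> t0; have [C [C0 hC]] := fourier_symbol_le 2.
set K := N%:R * (1 + tau ^- 2) + tau ^- 4 : R.
have K0 : 0 < K.
  by rewrite ltr_wpDl ?invr_gt0 ?exprn_gt0// mulr_ge0// addr_ge0// invr_ge0 sqr_ge0.
have pi0 : 0 < pi :> R by exact: pi_gt0.
have pi20 : 0 < 2 * pi :> R by lra.
exists ((2 * pi) ^- N * (K * C * (pi / tau) ^+ N)); split.
  apply: mulr_gt0; first by rewrite invr_gt0 exprn_gt0// pi20.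
  by apply: mulr_gt0; rewrite ?exprn_gt0 ?divr_gt0//; apply: mulr_gt0.
move=> x y s t ts tt; rewrite !biharmonic_kernelE -mulrBr normrM ger0_norm; last first.
  by rewrite invr_ge0 exprn_ge0// mulr_ge0// ltW.
rewrite -[leRHS]mulrA ler_wpM2l ?invr_ge0 ?exprn_ge0 ?mulr_ge0 ?(ltW pi0)//.
have isym r : tau ^+ 4 <= r -> (lebesgue_rV R N).-integrable setT (EFin \o fourier_symbol r).
  move=> tr; apply: le_integrable (integrable_fourier_symbol t0) => //.
    by apply/measurable_EFinP; exact: measurable_fourier_symbol.
  move=> xi _ /=; rewrite lee_fin !ger0_norm ?expR_ge0// ler_expR lerN2.
  by rewrite ler_wpM2r// sqr_ge0.
rewrite -RintegralB//; [|exact/integrable_cos_dotr/isym|exact/integrable_cos_dotr/isym].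
set D := `|x - y| + `|s - t|.
have D0 : 0 <= D by rewrite addr_ge0.
set g := fun xi => _ - _.
have mg : measurable_fun setT g.
  apply: measurable_funB; apply: measurable_funM; [exact: measurable_cos_dotr
    |exact: measurable_fourier_symbol|exact: measurable_cos_dotr|exact: measurable_fourier_symbol].
have gle xi : `|g xi| <= (D * K * C) * cauchyw tau xi.
  apply: le_trans (norm_symbolB_le x y xi t0 ts tt) _.
  by rewrite -2![leRHS]mulrA ler_wpM2l// ler_wpM2l ?(ltW K0)// hC.
have [|le ig] := integrable_le_cauchyw t0 _ mg gle.
  by rewrite !mulr_ge0 ?(ltW K0) ?(ltW C0).
rewrite -lee_fin EFin_normr_Rintegral//.
apply: (le_trans (le_abse_integral (lebesgue_rV R N) measurableT _)).
  exact/measurable_EFinP.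
apply: le_trans le _; rewrite lee_fin.
by rewrite le_eqVlt; apply/predU1P; left; ring.
Qed.

End kernel.

(** * Bounds on the kernel and its increments by the majorant *)

Section fourth_root.
Context {R : realType}.
Implicit Types t : R.

Definition root4 t : R := t `^ 4^-1.

Lemma root4_ge0 t : 0 <= root4 t.
Proof. exact: powR_ge0. Qed.

Lemma root4_gt0 t : 0 < t -> 0 < root4 t.
Proof. exact: powR_gt0. Qed.

Lemma root4K t : 0 <= t -> root4 t ^+ 4 = t.
Proof. by move=> t0; rewrite -powR_mulrn ?powR_ge0// -powRrM mulVf// powRr1. Qed.

Lemma root4_le s t : 0 <= s -> s <= t -> root4 s <= root4 t.
Proof.
by move=> s0 st; rewrite ge0_ler_powR ?nnegrE// (le_trans s0).
Qed.

Lemma root4_powR t (b : R) : root4 t `^ b = t `^ (b / 4).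
Proof. by rewrite /root4 -powRrM mulrC. Qed.

End fourth_root.

(** The geometric mean of the two bounds: half of the Lipschitz gain [D] is given up to keep one
    power of the integrable majorant [m]. *)
Lemma le_sqrt_interpolation {R : realType} (v a b D m : R) :
  0 <= a -> 0 <= b -> 0 <= D -> 0 <= m -> 0 <= v ->
  v <= a * D -> v <= b * m ^+ 2 -> v <= Num.sqrt (a * b) * Num.sqrt D * m.
Proof.
move=> a0 b0 D0 m0 v0 h1 h2.
rewrite -(@ler_pXn2r _ 2) ?nnegrE ?mulr_ge0 ?sqrtr_ge0//.
rewrite !exprMn !sqr_sqrtr ?mulr_ge0// expr2.
rewrite [leRHS](_ : _ = (a * D) * (b * m ^+ 2)); last by ring.
exact: ler_pM.
Qed.

Section kernel_majorant.
Context {R : realType} {N : nat}.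
Implicit Types x y : 'rV[R]_N.

Lemma biharmonic_kernel_le_maj : exists C : R, 0 < C /\
  forall x t, 0 < t -> `|biharmonic_kernel x t| <= C * maj (root4 t) x.
Proof.
(* Order [2N] is what turns [tau^(-N) (tau/m)^k] into [tau^N / m^(2N)]. *)
have [C [C0 hC]] := @biharmonic_kernel_decay R N (2 * N).
exists C; split=> // x t t0.
have r0 := root4_gt0 t0.
have := hC (root4 t) x r0; rewrite root4K ?(ltW t0)//.
rewrite -mulrA (_ : _ ^- N * _ = maj (root4 t) x)//.
rewrite /maj expr_div_n mulrA; congr (_ / _).
by rewrite mul2n -addnn exprD mulKf// expf_neq0// gt_eqF.
Qed.

Lemma biharmonic_kernel_le_sqr_maj (d T : R) : 0 < d -> exists C : R, 0 < C /\
  forall x t, d <= t <= T -> `|biharmonic_kernel x t| <= C * maj 1 x ^+ 2.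
Proof.
move=> d0; have [C [C0 hC]] := @biharmonic_kernel_decay R N (4 * N).
(* Passes from the scale [root4 t] to the scale 1, common to all times of the range: [root4 t /
   max(root4 t,|x|) <= c / max(1,|x|)]. *)
pose c := Num.max 1 (root4 T).
have c1 : 1 <= c by rewrite le_max lexx.
have c0 : 0 < c by exact: lt_le_trans c1.
exists (C * root4 d ^- N * c ^+ (4 * N)); split.
  by rewrite mulr_gt0 ?exprn_gt0// mulr_gt0// invr_gt0 exprn_gt0 ?root4_gt0.
move=> x t /andP[dt tT]; have t0 : 0 < t by exact: lt_le_trans dt.
have r0 := root4_gt0 t0.
have := hC (root4 t) x r0; rewrite root4K ?(ltW t0)// => /le_trans; apply.
have m1 : 0 < Num.max 1 `|x| by rewrite lt_max ltr01.
have mr : 0 < Num.max (root4 t) `|x| by rewrite lt_max r0.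
have mE : maj 1 x ^+ 2 = (Num.max 1 `|x|)^-1 ^+ (4 * N).
  rewrite /maj expr1n div1r !exprVn -exprM; congr ((_ ^+ _)^-1); lia.
rewrite mE -[leRHS]mulrA -exprMn; apply: ler_pM.
- by rewrite mulr_ge0 ?(ltW C0)// invr_ge0 exprn_ge0 ?(ltW r0).
- by rewrite exprn_ge0// divr_ge0 ?(ltW r0) ?(ltW mr).
- rewrite ler_wpM2l ?(ltW C0)// lef_pV2 ?posrE ?exprn_gt0 ?root4_gt0//.
  by rewrite lerXn2r ?nnegrE ?root4_ge0// root4_le ?(ltW d0).
- have [cr mc] : root4 t <= c /\ Num.max (root4 t) `|x| <= c * Num.max (root4 t) `|x|.
    by rewrite ler_peMl ?(ltW mr)// le_max root4_le ?(ltW t0) ?orbT.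
  rewrite lerXn2r ?nnegrE ?divr_ge0 ?(ltW r0) ?(ltW mr) ?(ltW c0) ?(ltW m1)//.
  rewrite ler_pdivrMr// mulrAC ler_pdivlMr// maxr_pMr ?(ltW r0)// ge_max mulr1.
  rewrite (le_trans _ mc) ?le_max ?lexx//= ler_pM ?(ltW r0)//.
  by rewrite le_max lexx orbT.
Qed.

(** A displacement of at most 1 at most doubles [max(1,|.|)]. This lets increments of the kernel be
    measured by the majorant at one of the two points. *)
Lemma maj1_le x y : `|x - y| <= 1 -> maj 1 y <= 2 ^+ (2 * N) * maj 1 x.
Proof.
move=> xy; have m1 (z : 'rV[R]_N) : 0 < Num.max 1 `|z| by rewrite lt_max ltr01.
rewrite /maj expr1n !div1r ler_pdivlMr ?exprn_gt0// mulrC ler_pdivrMr ?exprn_gt0//.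
rewrite -exprMn lerXn2r ?nnegrE ?mulr_ge0 ?(ltW (m1 _))//.
have h1 : 1 <= Num.max 1 `|y| by rewrite le_max lexx.
have h2 : `|y| <= Num.max 1 `|y| by rewrite le_max lexx orbT.
rewrite ge_max; apply/andP; split; first by lra.
have := ler_distD y x 0; rewrite !subr0; lra.
Qed.

Lemma biharmonic_kernelB_le_maj (d T : R) : 0 < d -> exists C : R, 0 < C /\
  forall x y s t, d <= s <= T -> d <= t <= T -> `|x - y| <= 1 ->
  `|biharmonic_kernel x s - biharmonic_kernel y t| <=
     C * Num.sqrt (`|x - y| + `|s - t|) * maj 1 x.
Proof.
move=> d0; have [C [C0 hC]] := @biharmonic_kernel_le_sqr_maj d T d0.
have [L [L0 hL]] := @biharmonic_kernel_lipschitz R N (root4 d) (root4_gt0 d0).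
rewrite root4K ?(ltW d0)// in hL.
pose K := C * (1 + 2 ^+ (2 * N) ^+ 2).
have K0 : 0 < K by rewrite mulr_gt0// addr_gt0// exprn_gt0// exprn_gt0.
exists (Num.sqrt (L * K)); split; first by rewrite sqrtr_gt0 mulr_gt0.
move=> x y s t sI tI xy; set D := `|x - y| + `|s - t|.
have D0 : 0 <= D by rewrite addr_ge0.
have m0 : 0 <= maj 1 x by exact: maj_ge0.
have h1 : `|biharmonic_kernel x s - biharmonic_kernel y t| <= L * D.
  by apply: hL; [case/andP: sI|case/andP: tI].
have h2 : `|biharmonic_kernel x s - biharmonic_kernel y t| <= K * maj 1 x ^+ 2.
  apply: le_trans (ler_normB _ _) _; rewrite /K mulrDr mulr1 mulrDl.
  apply: lerD; first exact: hC.
  apply: le_trans (hC _ _ tI) _; rewrite -mulrA ler_wpM2l ?(ltW C0)// -exprMn.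
  by rewrite lerXn2r ?nnegrE ?mulr_ge0 ?exprn_ge0 ?maj_ge0// maj1_le.
exact: le_sqrt_interpolation (ltW L0) (ltW K0) D0 m0 _ h1 h2.
Qed.

End kernel_majorant.

Lemma Rintegral_le_majorant {R : realType} d (T : measurableType d)
    (m : {sigma_finite_measure set T -> \bar R}) (k w f : T -> R) (c B : R) :
  measurable_fun setT k -> measurable_fun setT w -> measurable_fun setT f ->
  0 <= c -> (forall y, 0 <= w y) -> (forall y, `|k y| <= c * w y) ->
  (\int[m]_y (w y * `|f y|)%:E <= B%:E)%E ->
  m.-integrable setT (fun y => (k y * f y)%:E) /\
  `|\int[m]_y (k y * f y)| <= c * B.
Proof.
move=> mk mw mf c0 w0 kw wB.
have mkf : measurable_fun setT (fun y => k y * f y) by exact: measurable_funM.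
have mkfE : measurable_fun setT (fun y => (k y * f y)%:E) by exact/measurable_EFinP.
have mwf : measurable_fun setT (fun y => (w y * `|f y|)%:E).
  apply/measurable_EFinP/measurable_funM => //; exact: measurableT_comp.
have le : (\int[m]_y `|(k y * f y)%:E| <= (c * B)%:E)%E.
  apply: (@le_trans _ _ (\int[m]_y (c%:E * (w y * `|f y|)%:E))%E).
    apply: ge0_le_integral => //.
    - exact: measurableT_comp.
    - exact: measurable_funeM.
    - by move=> y _; rewrite -EFinM lee_fin normrM mulrA ler_wpM2r.
  rewrite ge0_integralZl//.
  - by rewrite EFinM lee_wpmul2l.
  - by move=> y _; rewrite lee_fin mulr_ge0.
have ikf : m.-integrable setT (fun y => (k y * f y)%:E).
  by apply/integrableP; split => //; apply: le_lt_trans le _; rewrite ltry.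
split => //; rewrite -lee_fin EFin_normr_Rintegral//.
exact: le_trans (le_abse_integral _ _ mkfE) le.
Qed.

(** * Semigroup and Duhamel estimates *)

Section semigroup_estimates.
Context {R : realType} {N : nat}.
Implicit Types (x y : 'rV[R]_N) (f : 'rV[R]_N -> R).

(* The parabolic distance to the origin, up to equivalence of norms. *)
Definition pnorm x (t : R) : R := Num.max `|x| (root4 t).

Lemma pnorm_gt0 x t : 0 < t -> 0 < pnorm x t.
Proof. by move=> t0; rewrite lt_max root4_gt0 ?orbT. Qed.

(** All that the semigroup estimates ask of a function. It treats alike the datum, singular at the
    origin, and the sources, bounded at each positive time. *)
Definition conv_bounded (a B : R) f := measurable_fun setT f /\
  forall (tau : R) x, 0 < tau ->
    (\int[lebesgue_rV R N]_y (maj tau (x - y) * `|f y|)%:E <=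
     (B * Num.max `|x| tau `^ (- a))%:E)%E.

Lemma conv_bounded_weight (a : R) : 0 <= a < N%:R -> exists A : R, 0 < A /\
  forall (sigma L : R) f, 0 < sigma -> 0 <= L -> measurable_fun setT f ->
    (forall y, `|f y| <= L * Num.max `|y| sigma `^ (- a)) ->
    conv_bounded a (A * L) f.
Proof.
move=> aN; have [A [A0 hA]] := conv_maj_le aN.
exists A; split=> // sigma L f s0 L0 mf fL; split=> // tau x t0.
have mw : measurable_fun setT
    (fun y : 'rV[R]_N => (maj tau (x - y) * Num.max `|y| sigma `^ (- a))%:E).
  apply/measurable_EFinP/measurable_funM; first exact: measurable_maj.
  apply: (measurableT_comp (measurable_powR (- a))).
  by apply: measurable_maxr => //; exact: measurable_norm_rV.
apply: (@le_trans _ _ (\int[lebesgue_rV R N]_y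
    (L%:E * (maj tau (x - y) * Num.max `|y| sigma `^ (- a))%:E))%E).
  apply: ge0_le_integral => //.
  - by move=> y _; rewrite lee_fin mulr_ge0 ?maj_ge0// ltW.
  - apply/measurable_EFinP/measurable_funM; first exact: measurable_maj.
    exact: measurableT_comp.
  - exact: measurable_funeM.
  - by move=> y _; rewrite -EFinM lee_fin mulrCA ler_wpM2l ?maj_ge0// ltW.
rewrite ge0_integralZl//; last first.
  by move=> y _; rewrite lee_fin mulr_ge0 ?powR_ge0// maj_ge0// ltW.
apply: le_trans (lee_wpmul2l _ (hA _ _ x t0 s0)) _; first by rewrite lee_fin.
by rewrite -EFinM lee_fin mulrA (mulrC L).
Qed.

Lemma measurable_kernel_sub x t :
  measurable_fun setT (fun y => biharmonic_kernel (x - y) t).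
Proof.
apply: (measurableT_comp (@measurable_biharmonic_kernel R N)
  (g := fun y : 'rV[R]_N => (x - y, t))).
apply/measurable_fun_pairP; split; last exact: measurable_cst.
exact: (@measurable_rVB R N _ _ (fun=> x) id).
Qed.

Lemma semigroup_le : exists C : R, 0 < C /\ forall a B f x t,
  conv_bounded a B f -> 0 < t ->
  biharmonic_semigroup_integrable t f x /\
  `|biharmonic_semigroup t f x| <= C * (B * pnorm x t `^ (- a)).
Proof.
have [C [C0 hC]] := @biharmonic_kernel_le_maj R N.
exists C; split=> // a B f x t [mf fB] t0.
have r0 := root4_gt0 t0.
apply: (Rintegral_le_majorant (w := fun y => maj (root4 t) (x - y))) => //.
- exact: measurable_kernel_sub.
- exact: measurable_maj.
- exact: ltW.
- by move=> y; rewrite maj_ge0// ltW.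
- by move=> y; exact: hC.
- exact: fB.
Qed.

Lemma semigroupB_le (d T : R) : 0 < d -> exists C : R, 0 < C /\
  forall a B f x y s t, 0 <= a -> 0 <= B -> conv_bounded a B f ->
  d <= s <= T -> d <= t <= T -> `|x - y| <= 1 ->
  `|biharmonic_semigroup s f x - biharmonic_semigroup t f y| <=
     C * Num.sqrt (`|x - y| + `|s - t|) * B.
Proof.
move=> d0; have [C [C0 hC]] := @biharmonic_kernelB_le_maj R N d T d0.
have [C1 [_ hS]] := semigroup_le.
exists C; split=> // a B f x y s t a0 B0 [mf fB] sI tI xy.
have s0 : 0 < s by case/andP: sI => ds _; exact: lt_le_trans ds.
have t0 : 0 < t by case/andP: tI => dt _; exact: lt_le_trans dt.
have [isx _] := hS _ _ _ x _ (conj mf fB) s0.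
have [ity _] := hS _ _ _ y _ (conj mf fB) t0.
rewrite /biharmonic_semigroup -RintegralB//.
under eq_Rintegral do rewrite -mulrBl.
apply: le_trans (_ : C * Num.sqrt (`|x - y| + `|s - t|) *
    (B * Num.max `|x| 1 `^ (- a)) <= _); last first.
  rewrite ler_wpM2l// ?mulr_ge0 ?(ltW C0)// ler_piMr//.
  have m1 : 1 <= Num.max `|x| 1 by rewrite le_max lexx orbT.
  by rewrite -[leRHS](powRr0 (Num.max `|x| 1)) ler_powR// oppr_le0.
have [|||||||] // := @Rintegral_le_majorant R _ _ (lebesgue_rV R N)
  (fun z => biharmonic_kernel (x - z) s - biharmonic_kernel (y - z) t)
  (fun z => maj 1 (x - z)) f (C * Num.sqrt (`|x - y| + `|s - t|))
  (B * Num.max `|x| 1 `^ (- a)).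
- by apply: measurable_funB; exact: measurable_kernel_sub.
- exact: measurable_maj.
- by rewrite mulr_ge0 ?(ltW C0).
- by move=> z; rewrite maj_ge0.
- move=> z; have := hC (x - z) (y - z) s t sI tI.
  by rewrite opprB addrA addrNK; apply.
- exact: fB.
Qed.

End semigroup_estimates.

(** * The Duhamel operator on sources decaying like [pnorm] to the power [- (beta + 4)] *)

Section duhamel.
Context {R : realType} {N : nat} (beta a : R).
Hypothesis beta0 : 0 < beta.
Hypothesis beta_a : beta < a.
Hypothesis aN : a < N%:R.
Hypothesis a_beta4 : a < beta + 4.
Implicit Types (x y : 'rV[R]_N) (F : R -> 'rV[R]_N -> R).
Let g := (a - beta) / 4.

Definition source_bounded (L : R) F :=
  measurable_fun setT (fun z : 'rV[R]_N * R => F z.2 z.1) /\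
  forall s y, 0 < s -> `|F s y| <= L * pnorm y s `^ (- (beta + 4)).

Definition duhamel F x (t : R) : R :=
  \int[@lebesgue_measure R]_(s in `]0, t[%classic) biharmonic_semigroup (t - s) (F s) x.

Let a0 : 0 < a. Proof. exact: lt_trans beta_a. Qed.
Let N0 : 0 < N%:R :> R. Proof. exact: lt_trans aN. Qed.
Let g0 : 0 < g. Proof. by rewrite divr_gt0// subr_gt0. Qed.

Lemma measurable_source L F s : source_bounded L F -> measurable_fun setT (F s).
Proof.
case=> mF _; apply: (measurableT_comp mF (g := fun y : 'rV[R]_N => (y, s))).
exact: measurable_pair2.
Qed.

Lemma source_conv_bounded : exists A : R, 0 < A /\
  forall (L : R) F (s : R), 0 <= L -> source_bounded L F -> 0 < s ->
    conv_bounded a (A * (L * s `^ (g - 1))) (F s) /\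
    conv_bounded 0 (A * (L * root4 s `^ (- (beta + 4)))) (F s).
Proof.
have [|A1 [A10 h1]] := @conv_bounded_weight R N a; first by rewrite ltW.
have [|A2 [A20 h2]] := @conv_bounded_weight R N 0; first by rewrite lexx.
exists (A1 + A2); split; first exact: addr_gt0.
have mono (a' B B' : R) (f : 'rV[R]_N -> R) : B <= B' -> conv_bounded a' B f -> conv_bounded a' B' f.
  move=> BB' [mf hf]; split=> // tau x t0; apply: le_trans (hf tau x t0) _.
  by rewrite lee_fin ler_wpM2r ?powR_ge0.
move=> L F s L0 LF s0; have [mF hF] := LF; have r0 := root4_gt0 s0.
have mFs := measurable_source s LF.
split.
  apply: (@mono _ (A1 * (L * s `^ (g - 1)))).
    by rewrite ler_wpM2r ?mulr_ge0 ?powR_ge0// lerDl ltW.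
  apply: (h1 _ _ _ r0) => //; first by rewrite mulr_ge0 ?powR_ge0.
  move=> y; apply: le_trans (hF s y s0) _; rewrite -mulrA ler_wpM2l// -/(pnorm y s).
  have p0 := pnorm_gt0 y s0.
  have -> : - (beta + 4) = - (beta + 4 - a) + - a by ring.
  rewrite powRD ?(gt_eqF p0) ?implybT// ler_wpM2r ?powR_ge0//.
  have -> : s `^ (g - 1) = root4 s `^ (- (beta + 4 - a)).
    by rewrite root4_powR; congr powR; rewrite /g; field.
  rewrite !powRN lef_pV2 ?posrE ?powR_gt0//.
  have : 0 <= beta + 4 - a by rewrite subr_ge0 ltW.
  move=> /ge0_ler_powR; apply; rewrite ?nnegrE ?(ltW r0) ?(ltW p0)//.
  by rewrite /pnorm le_max lexx orbT.
apply: (@mono _ (A2 * (L * root4 s `^ (- (beta + 4))))).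
  by rewrite ler_wpM2r ?mulr_ge0 ?powR_ge0// lerDr ltW.
apply: (h2 _ _ _ r0) => //; first by rewrite mulr_ge0 ?powR_ge0.
move=> y; rewrite oppr0 powRr0 mulr1; apply: le_trans (hF s y s0) _.
rewrite ler_wpM2l// !powRN lef_pV2 ?posrE ?powR_gt0 ?pnorm_gt0//.
have : 0 <= beta + 4 by rewrite addr_ge0 ?ltW.
move=> /ge0_ler_powR; apply; rewrite ?nnegrE ?(ltW r0) ?(ltW (pnorm_gt0 _ _))//.
by rewrite /pnorm le_max lexx orbT.
Qed.

Lemma half_root4_le (s t : R) : 0 <= t -> t / 16 <= s -> root4 t / 2 <= root4 s.
Proof.
move=> t0 ts; have s0 : 0 <= s by apply: le_trans ts; rewrite divr_ge0.
rewrite -(@ler_pXn2r _ 4) ?nnegrE ?divr_ge0 ?root4_ge0//.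
by rewrite expr_div_n !root4K// (_ : 2 ^+ 4 = 16)//; ring.
Qed.

(** The estimate with exponent [a] involves [pnorm x (t - s)]. If this is at least half of
    [pnorm x t], it suffices. Otherwise [|x|] and [t - s] are both small, so that [s] is comparable
    to [t]; the estimate with exponent 0 then has the right size, as [root4 s^(-(beta+4)) = s^(g-1)
    root4 s^(-a)]. *)
Lemma semigroup_source_le : exists C : R, 0 < C /\
  forall (L : R) F x (s t : R), 0 <= L -> source_bounded L F -> 0 < s < t ->
  [/\ biharmonic_semigroup_integrable (t - s) (F s) x,
      `|biharmonic_semigroup (t - s) (F s) x| <=
        C * L * pnorm x t `^ (- a) * s `^ (g - 1) &
      `|biharmonic_semigroup (t - s) (F s) x| <=
        C * L * root4 s `^ (- (beta + 4))].
Proof.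
have [A [A0 hA]] := source_conv_bounded.
have [C [C0 hC]] := @semigroup_le R N.
have CA0 : 0 < C * A by exact: mulr_gt0.
have pow2 : 1 <= 2 `^ a :> R by rewrite -[leLHS](powRr0 2) ler_powR ?ler1n// ltW.
exists (C * A * 2 `^ a); split; first by rewrite mulr_gt0// powR_gt0.
move=> L F x s t L0 LF /andP[s0 st].
have [b1 b2] := hA _ _ _ L0 LF s0.
have ts0 : 0 < t - s by rewrite subr_gt0.
have t0 : 0 < t by exact: lt_trans st.
have [iF h1] := hC _ _ _ x _ b1 ts0.
have [_ h2] := hC _ _ _ x _ b2 ts0.
rewrite oppr0 powRr0 mulr1 in h2.
have p0 := pnorm_gt0 x t0; have p1 := pnorm_gt0 x ts0.
have r0 := root4_gt0 s0.
have half (z : R) : 0 < z -> pnorm x t / 2 <= z ->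
    z `^ (- a) <= 2 `^ a * pnorm x t `^ (- a).
  move=> z0 h; have -> : 2 `^ a = 2^-1 `^ (- a) :> R.
    by rewrite -[2^-1]powR_inv1// -powRrM mulrNN mul1r.
  rewrite -powRM ?invr_ge0 ?(ltW p0)// !powRN lef_pV2 ?posrE ?powR_gt0//; last first.
    by rewrite mulr_gt0 ?invr_gt0.
  have := ltW a0; move=> /ge0_ler_powR; apply; rewrite ?nnegrE ?(ltW z0)//.
    by rewrite mulr_ge0 ?invr_ge0 ?(ltW p0).
  by rewrite mulrC.
split=> //; last first.
  apply: le_trans h2 _; rewrite [leRHS](_ : _ = C * A * L * root4 s `^ (- (beta + 4)) * 2 `^ a); last by ring.
  rewrite [leLHS](_ : _ = C * A * L * root4 s `^ (- (beta + 4)) * 1); last by ring.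
  by rewrite ler_wpM2l// !mulr_ge0 ?powR_ge0 ?(ltW CA0) ?(ltW C0) ?(ltW A0).
rewrite [leRHS](_ : _ = C * A * L * (s `^ (g - 1) * (2 `^ a * pnorm x t `^ (- a)))); last by ring.
have CAL0 : 0 <= C * A * L by rewrite mulr_ge0// ltW.
have [hp|hp] := leP (pnorm x t / 2) (pnorm x (t - s)).
  apply: le_trans h1 _.
  rewrite [leLHS](_ : _ = C * A * L * (s `^ (g - 1) * pnorm x (t - s) `^ (- a))); last by ring.
  by rewrite ler_wpM2l// ler_wpM2l ?powR_ge0// half.
apply: le_trans h2 _; rewrite [leLHS](_ : _ = C * A * L * root4 s `^ (- (beta + 4))); last by ring.
apply: (ler_wpM2l CAL0).
have -> : root4 s `^ (- (beta + 4)) = s `^ (g - 1) * root4 s `^ (- a).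
  rewrite !root4_powR -powRD ?(gt_eqF s0) ?implybT//; congr powR; rewrite /g.
  by field.
apply: ler_wpM2l; first exact: powR_ge0.
apply: half => //.
have xp : `|x| < pnorm x t / 2 by apply: le_lt_trans hp; rewrite /pnorm le_max lexx.
have rp : root4 (t - s) < pnorm x t / 2 by apply: le_lt_trans hp; rewrite /pnorm le_max lexx orbT.
have pE : pnorm x t = root4 t.
  rewrite /pnorm; apply/max_idPr; rewrite leNgt; apply/negP => tx.
  move: xp; rewrite /pnorm (max_idPl (ltW tx)) => h.
  have := root4_ge0 t; lra.
rewrite pE; apply: half_root4_le; first exact: ltW.
(* If [s < t/16], then [t - s >= t/16], and [root4 (t - s)] would be at least [root4 t / 2]. *)
rewrite leNgt; apply/negP => h; move: rp; rewrite ltNge => /negP; apply.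
rewrite pE; apply: half_root4_le; [exact: ltW|lra].
Qed.

Lemma measurable_duhamel_integrand F :
  measurable_fun setT (fun z : 'rV[R]_N * R => F z.2 z.1) ->
  measurable_fun setT (fun z : ('rV[R]_N * R) * R =>
    biharmonic_semigroup (z.1.2 - z.2) (F z.2) z.1.1).
Proof.
move=> mF.
apply: (@measurable_Rintegral R _ _ (('rV[R]_N * R) * R)%type 'rV[R]_N (lebesgue_rV R N)
  (fun w => biharmonic_kernel (w.1.1.1 - w.2) (w.1.1.2 - w.1.2) * F w.1.2 w.2)).
have m1 : measurable_fun setT (fun w : (('rV[R]_N * R) * R) * 'rV[R]_N => w.1.1).
  by apply: measurableT_comp.
have m2 : measurable_fun setT (fun w : (('rV[R]_N * R) * R) * 'rV[R]_N => w.1.2).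
  by apply: measurableT_comp.
apply: measurable_funM.
  apply: (measurableT_comp (@measurable_biharmonic_kernel R N)
    (g := fun w : (('rV[R]_N * R) * R) * 'rV[R]_N => (w.1.1.1 - w.2, w.1.1.2 - w.1.2))).
  apply/measurable_fun_pairP; split.
    apply: (@measurable_rVB R N _ _ (fun w : (('rV[R]_N * R) * R) * 'rV[R]_N => w.1.1.1) (fun w => w.2)).
      exact: measurableT_comp.
    exact: measurable_snd.
  have : measurable_fun setT (fun w : (('rV[R]_N * R) * R) * 'rV[R]_N => w.1.1.2 - w.1.2).
    by apply: measurable_funB => //; exact: measurableT_comp.
  by [].
apply: (measurableT_comp mF (g := fun w : (('rV[R]_N * R) * R) * 'rV[R]_N => (w.2, w.1.2))).
by apply/measurable_fun_pairP; split; [exact: measurable_snd|exact: m2].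
Qed.

Lemma measurable_duhamel_integrand1 F x (t : R) :
  measurable_fun setT (fun z : 'rV[R]_N * R => F z.2 z.1) ->
  measurable_fun setT (fun s : R => biharmonic_semigroup (t - s) (F s) x).
Proof.
move=> /measurable_duhamel_integrand mF.
apply: (measurableT_comp mF (g := fun s : R => ((x, t), s))).
exact: measurable_pair1.
Qed.

Lemma measurable_duhamel F : measurable_fun setT (fun z : 'rV[R]_N * R => F z.2 z.1) ->
  measurable_fun setT (fun z : 'rV[R]_N * R => duhamel F z.1 z.2).
Proof.
move=> mF; rewrite /duhamel.
(* The domain []0, t[] varies with the parameter, so it is first moved into the integrand. *)
under eq_fun do rewrite Rintegral_mkcond.
apply: (@measurable_Rintegral R _ _ ('rV[R]_N * R)%type (measurableTypeR R) (@lebesgue_measure R)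
  (fun z => ((fun s : R => biharmonic_semigroup (z.1.2 - s) (F s) z.1.1) \_ `]0, z.1.2[) z.2)).
rewrite /patch; under eq_fun do rewrite mem_setE in_itv/=.
apply: measurable_fun_ifT; last exact: measurable_cst.
  apply: measurable_and; apply: measurable_fun_ltr => //.
  exact: measurableT_comp.
exact: measurable_duhamel_integrand.
Qed.

Lemma duhamel_le : exists C : R, 0 < C /\
  forall (L : R) F x (t : R), 0 <= L -> source_bounded L F -> 0 < t ->
  (@lebesgue_measure R).-integrable `]0, t[%classic
     (fun s => (biharmonic_semigroup (t - s) (F s) x)%:E) /\
  `|duhamel F x t| <= C * L * pnorm x t `^ (- beta).
Proof.
have [C [C0 hC]] := semigroup_source_le.
exists (C / g); split; first exact: divr_gt0.
move=> L F x t L0 LF t0.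
have p0 := pnorm_gt0 x t0.
have mS := measurable_duhamel_integrand1 x t LF.1.
have mSE : measurable_fun `]0, t[ (fun s => (biharmonic_semigroup (t - s) (F s) x)%:E).
  by apply: measurable_funTS; exact/measurable_EFinP.
have K0 : 0 <= C * L * pnorm x t `^ (- a) by rewrite !mulr_ge0 ?powR_ge0// ltW.
have mp : measurable_fun setT (fun s : R => (s `^ (g - 1))%:E).
  by apply/measurable_EFinP; exact: measurable_powR.
have le : (\int[@lebesgue_measure R]_(s in `]0%R, t[)
    `|(biharmonic_semigroup (t - s) (F s) x)%:E| <=
    (C / g * L * pnorm x t `^ (- beta))%:E)%E.
  apply: (@le_trans _ _ (\int[@lebesgue_measure R]_(s in `]0%R, t[)
     ((C * L * pnorm x t `^ (- a))%:E * (s `^ (g - 1))%:E))%E).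
    apply: ge0_le_integral => //.
    - exact: measurableT_comp.
    - by apply: measurable_funeM; exact: measurable_funTS.
    - move=> s /=; rewrite in_itv/= => st; rewrite -EFinM lee_fin.
      by have [_ h _] := hC _ _ x _ _ L0 LF st.
  rewrite ge0_integralZl//; last first.
  - by move=> s _; rewrite lee_fin powR_ge0.
  - exact: measurable_funTS.
  apply: le_trans (lee_wpmul2l _ (ge0_integral_powR_le g0 t0)) _; first by rewrite lee_fin.
  rewrite -EFinM lee_fin.
  rewrite [leLHS](_ : _ = C / g * L * (pnorm x t `^ (- a) * t `^ g)); last by ring.
  rewrite ler_wpM2l//; first by rewrite !mulr_ge0 ?invr_ge0// ltW.
  (* The time integral gains exactly the power that turns the decay [a] back into [beta], because
     [root4 t <= pnorm x t]. *)
  have -> : t `^ g = root4 t `^ (a - beta) by rewrite root4_powR.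
  rewrite [X in _ <= pnorm x t `^ X](_ : _ = - a + (a - beta)); last by ring.
  rewrite (@powRD _ (pnorm x t)) ?(gt_eqF p0) ?implybT// ler_wpM2l ?powR_ge0//.
  have : 0 <= a - beta by rewrite subr_ge0 ltW.
  move=> /ge0_ler_powR; apply; rewrite ?nnegrE ?root4_ge0 ?(ltW p0)//.
  by rewrite /pnorm le_max lexx orbT.
have iS : (@lebesgue_measure R).-integrable `]0, t[%classic
     (fun s => (biharmonic_semigroup (t - s) (F s) x)%:E).
  by apply/integrableP; split => //; apply: le_lt_trans le _; rewrite ltry.
split => //; rewrite -lee_fin EFin_normr_Rintegral//.
by apply: le_trans le; exact: le_abse_integral.
Qed.

Lemma duhamelB (L L' : R) F F' x (t : R) : 0 <= L -> 0 <= L' -> source_bounded L F ->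
  source_bounded L' F' -> 0 < t ->
  duhamel F x t - duhamel F' x t = duhamel (fun s y => F s y - F' s y) x t.
Proof.
move=> L0 L'0 LF LF' t0; have [C [C0 hC]] := duhamel_le.
have [C' [_ hC']] := semigroup_source_le.
have [i1 _] := hC _ _ x _ L0 LF t0; have [i2 _] := hC _ _ x _ L'0 LF' t0.
rewrite /duhamel -RintegralB//; apply: eq_Rintegral => s.
rewrite inE/= in_itv/= => st.
have [j1 _ _] := hC' _ _ x _ _ L0 LF st; have [j2 _ _] := hC' _ _ x _ _ L'0 LF' st.
rewrite /biharmonic_semigroup -RintegralB//.
by apply: eq_Rintegral => y _; rewrite mulrBr.
Qed.

End duhamel.

(** One modulus, jointly in space and time and uniform over space: it gives both the continuity of
    each time slice and the continuity in time for the sup norm. *)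
Definition unif_continuous_at {R : realType} {N : nat} (v : 'rV[R]_N -> R -> R) (t : R) :=
  forall e : R, 0 < e -> exists eta : R, 0 < eta /\
    forall x y t', `|x - y| < eta -> `|t - t'| < eta -> `|v x t - v y t'| <= e.

Lemma exists_sqrt_small {R : realType} (K c e : R) : 0 <= K -> 0 < c -> 0 < e ->
  exists eta : R, [/\ 0 < eta, eta <= c, eta <= 1 & K * Num.sqrt (2 * eta) <= e].
Proof.
move=> K0 c0 e0; pose r := e / (K + 1).
have K1 : 0 < K + 1 by rewrite ltr_wpDl.
have r0 : 0 < r by rewrite divr_gt0.
exists (Num.min (Num.min c 1) (r ^+ 2 / 2)); split.
- by rewrite !lt_min c0 ltr01 divr_gt0 ?exprn_gt0.
- by rewrite !ge_min lexx.
- by rewrite !ge_min lexx !orbT.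
- have h : Num.sqrt (2 * Num.min (Num.min c 1) (r ^+ 2 / 2)) <= r.
    rewrite -[leRHS](ger0_norm (ltW r0)) -sqrtr_sqr ler_wsqrtr//.
    by rewrite -ler_pdivlMl// mulrC ge_min lexx orbT.
  apply: le_trans (ler_wpM2l K0 h) _; rewrite /r mulrA ler_pdivrMr// mulrC.
  by rewrite ler_wpM2l ?(ltW e0)// lerDl.
Qed.

(** * Continuity of the Duhamel term, uniformly in space *)

Section duhamel_continuity.
Context {R : realType} {N : nat} (beta a : R).
Hypothesis beta0 : 0 < beta.
Hypothesis beta_a : beta < a.
Hypothesis aN : a < N%:R.
Hypothesis a_beta4 : a < beta + 4.
Implicit Types (x y : 'rV[R]_N) (F : R -> 'rV[R]_N -> R).
Let g := (a - beta) / 4.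
Let g0 : 0 < g. Proof. by rewrite divr_gt0// subr_gt0. Qed.

(** Extension by zero puts the Duhamel integrals at different times on one domain, so that they can
    be subtracted. *)
Let slice F x (t s : R) : R :=
  ((fun s => biharmonic_semigroup (t - s) (F s) x) \_ `]0, t[) s.

Let sliceE F x (t s : R) : slice F x t s =
  if 0 < s < t then biharmonic_semigroup (t - s) (F s) x else 0.
Proof. by rewrite /slice /patch mem_setE in_itv/=. Qed.

Let integrable_slice (L : R) F x (t : R) : 0 <= L -> source_bounded beta L F -> 0 < t ->
  (@lebesgue_measure R).-integrable setT (EFin \o slice F x t).
Proof.
move=> L0 LF t0; have [C [_ hC]] := @duhamel_le R N _ _ beta0 beta_a aN a_beta4.
have [+ _] := hC L F x t L0 LF t0.
by rewrite integrable_mkcond//= restrict_EFin.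
Qed.

(** Away from [s = 0] the source is bounded, so the integrand is bounded uniformly in [t], even near
    [s = t] where the modulus of continuity of the kernel degenerates. *)
Let slice_nearby_le : exists C : R, 0 < C /\ forall (L : R) F x (t s r : R),
  0 <= L -> source_bounded beta L F -> 0 < r -> r <= s ->
  `|slice F x t s| <= C * L * root4 r `^ (- (beta + 4)).
Proof.
have [C [C0 hC]] := @semigroup_source_le R N _ _ beta0 beta_a aN a_beta4.
exists C; split=> // L F x t s r L0 LF r0 rs.
have CL0 : 0 <= C * L by rewrite mulr_ge0 ?(ltW C0).
rewrite sliceE; case: ifPn => [st|_]; last by rewrite normr0 mulr_ge0 ?powR_ge0.
have [_ _ h] := hC L F x s t L0 LF st; apply: le_trans h _.
apply: ler_wpM2l; first exact: CL0.
have s0 : 0 < s by exact: lt_le_trans rs.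
rewrite !powRN lef_pV2; [|by rewrite posrE powR_gt0// root4_gt0..].
have : 0 <= beta + 4 by rewrite addr_ge0 ?ltW.
by move=> /ge0_ler_powR; apply; rewrite ?nnegrE ?root4_ge0// root4_le ?(ltW r0).
Qed.

Lemma duhamel_unif_continuous (L : R) F t : 0 <= L -> source_bounded beta L F ->
  0 < t -> unif_continuous_at (duhamel F) t.
Proof.
move=> L0 LF t0 e e0.
have [C1 [C10 h1]] := slice_nearby_le.
have [A [A0 hA]] := @source_conv_bounded R N _ _ beta0 beta_a aN a_beta4.
pose Q := C1 * L * root4 (t / 2) `^ (- (beta + 4)).
have Q0 : 0 <= Q by rewrite !mulr_ge0 ?powR_ge0// ltW.
have Q1 : 0 < Q + 1 by rewrite ltr_wpDl.
(* Half-scale of the layer around [s = t]. The first bound keeps the layer in [s >= t/2]; the second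
   makes its contribution, [2 Q] times the length [3 d], at most [e/2]. *)
pose d := Num.min (t / 4) (e / (12 * (Q + 1))).
have d0 : 0 < d by rewrite lt_min !divr_gt0// mulr_gt0.
have dt : d <= t / 4 by rewrite ge_min lexx.
have dQ : 6 * Q * d <= e / 2.
  have : d <= e / (12 * (Q + 1)) by rewrite ge_min lexx orbT.
  rewrite ler_pdivlMr ?mulr_gt0// => h; nra.
have [C2 [C20 h2]] := @semigroupB_le R N d (2 * t) d0.
(* Before the layer both kernel times are at least [d], and integrating the modulus of continuity
   against [s^(g-1)] gives [K] times the square root of [2 eta]. *)
pose K := C2 * A * L * (t `^ g / g).
have K0 : 0 <= K by rewrite !mulr_ge0 ?invr_ge0 ?powR_ge0// ltW.
have e20 : 0 < e / 2 by rewrite divr_gt0.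
have [eta [eta0 etad eta1 etaK]] := exists_sqrt_small K0 d0 e20.
exists eta; split=> // x y t' xy tt'.
have /ltr_normlP[tt1 tt2] := tt'.
have t'0 : 0 < t' by lra.
pose q := Num.sqrt (2 * eta).
have q0 : 0 <= q by exact: sqrtr_ge0.
pose c1 := C2 * q * A * L.
have c10 : 0 <= c1 by rewrite !mulr_ge0 ?(ltW C20) ?(ltW A0).
pose w (s : R) := ((fun s => s `^ (g - 1)) \_ `]0, t[) s.
have w0 s : 0 <= w s by rewrite /w /patch; case: ifP => // _; exact: powR_ge0.
(* As [t'] may exceed [t], but by less than [d], both slices vanish beyond [t + d]. *)
pose J : set R := `]t - 2 * d, t + d[%classic.
pose b (s : R) := c1 * w s + 2 * Q * \1_J s.
have cw s : 0 <= c1 * w s by exact: mulr_ge0.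
have QQ : 0 <= 2 * Q by exact: mulr_ge0.
have QJ s : 0 <= 2 * Q * \1_J s by exact: mulr_ge0.
have hb s : `|slice F x t s - slice F y t' s| <= b s.
  have b0 : 0 <= b s by exact: addr_ge0.
  have [s0|s0] := leP s 0.
    have ns r : (0 < s < r) = false by rewrite ltNge s0.
    by rewrite !sliceE !ns subrr normr0.
  have [sd|sd] := leP s (t - 2 * d).
    have st : 0 < s < t by rewrite s0/=; lra.
    have st' : 0 < s < t' by rewrite s0/=; lra.
    rewrite !sliceE st st'.
    have [cb _] := hA L F s L0 LF s0.
    have I1 : d <= t - s <= 2 * t by apply/andP; split; lra.
    have I2 : d <= t' - s <= 2 * t by apply/andP; split; lra.
    have xy1 : `|x - y| <= 1 by apply: ltW; exact: lt_le_trans eta1.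
    apply: le_trans (h2 a _ _ x y _ _ _ _ cb I1 I2 xy1) _.
    - by rewrite ltW// (lt_trans beta0).
    - by rewrite !mulr_ge0 ?powR_ge0 ?(ltW A0).
    - have wE : w s = s `^ (g - 1) by rewrite /w /patch mem_setE in_itv/= st.
      apply: (@le_trans _ _ (c1 * w s)); last by rewrite /b lerDl; exact: QJ.
      rewrite wE (_ : c1 * _ = C2 * q * (A * (L * s `^ (g - 1)))); last by rewrite /c1; ring.
      apply: ler_wpM2r; first by rewrite !mulr_ge0 ?powR_ge0 ?(ltW A0).
      apply: ler_wpM2l; first exact: ltW.
      rewrite /q; apply: ler_wsqrtr; rewrite (_ : t - s - (t' - s) = t - t'); last by ring.
      by rewrite mulr_natl mulr2n; apply: lerD; exact: ltW.
  have [std|std] := ltP s (t + d); last first.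
    have ns r : r <= s -> (0 < s < r) = false by move=> rs; rewrite (ltNge s r) rs andbF.
    by rewrite !sliceE !ns ?subrr ?normr0//; lra.
  have hs : t / 2 <= s by lra.
  have t20 : 0 < t / 2 by rewrite divr_gt0.
  have sJ : J s by rewrite /J/= in_itv/= sd std.
  rewrite /b indicE (mem_set sJ) mulr1 -[leLHS]add0r; apply: lerD; first exact: cw.
  apply: le_trans (ler_normB _ _) _; rewrite mulr_natl mulr2n.
  by apply: lerD; exact: h1.
have i1 := integrable_slice x L0 LF t0.
have i2 := integrable_slice y L0 LF t'0.
have dE z r : duhamel F z r = \int[@lebesgue_measure R]_s slice F z r s.
  by rewrite /duhamel Rintegral_mkcond.
have e12 := RintegralB measurableT i1 i2.
rewrite (dE x t) (dE y t').
rewrite -e12.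
have iB : (@lebesgue_measure R).-integrable setT
    (EFin \o (fun s => slice F x t s - slice F y t' s)).
  by have := integrableB measurableT i1 i2; apply: eq_integrable.
have mw : measurable_fun setT w.
  apply/(measurable_restrictT _ _).1 => //.
  by apply: measurable_funTS; exact: measurable_powR.
have mwE : measurable_fun setT (fun s => (w s)%:E) by exact/measurable_EFinP.
have mJ : measurable_fun setT (fun s => (\1_J s)%:E : \bar R).
  by apply/measurable_EFinP; apply: measurable_indic; exact: measurable_itv.
have Iw : (\int[@lebesgue_measure R]_s (w s)%:E <= (t `^ g / g)%:E)%E.
  apply: le_trans (ge0_integral_powR_le g0 t0).
  rewrite [leRHS]integral_mkcond [leRHS](_ : _ = \int[@lebesgue_measure R]_s (w s)%:E)%E//.
  by apply: eq_integral => s _; rewrite /w /patch; case: ifP.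
have Ib : (\int[@lebesgue_measure R]_s (b s)%:E <= (K * q + 6 * Q * d)%:E)%E.
  rewrite /b; under eq_integral do rewrite EFinD !EFinM -EFinM.
  rewrite ge0_integralD//; last 4 first.
  - by move=> s _; rewrite -EFinM lee_fin.
  - exact: measurable_funeM.
  - by move=> s _; rewrite -EFinM lee_fin.
  - exact: measurable_funeM.
  have Z (c : R) (f : R -> R) : 0 <= c -> (forall s, 0 <= f s) ->
      measurable_fun setT (fun s => (f s)%:E) ->
      (\int[@lebesgue_measure R]_s (c%:E * (f s)%:E) =
       c%:E * \int[@lebesgue_measure R]_s (f s)%:E)%E.
    by move=> ? f0 mf; rewrite ge0_integralZl// => s _; rewrite lee_fin.
  rewrite (Z _ _ c10 w0 mwE) (Z _ _ QQ _ mJ); last by move=> s.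
  rewrite EFinD; apply: leeD.
    apply: le_trans (lee_wpmul2l _ Iw) _; first by rewrite lee_fin.
    by rewrite -EFinM lee_fin le_eqVlt; apply/predU1P; left; rewrite /c1 /K; ring.
  have muJ : (@lebesgue_measure R J = (3 * d)%:E)%E.
    rewrite /J lebesgue_measure_itv/= lte_fin.
    have -> : t - 2 * d < t + d.
      by rewrite ltrD2l (@lt_trans _ _ 0)// oppr_lt0 mulr_gt0.
    by rewrite -EFinB; congr EFin; ring.
  rewrite integral_indic//; last exact: measurable_itv.
  rewrite setIT [X in (_ * X)%E](_ : _ = (3 * d)%:E); last exact: muJ.
  rewrite -EFinM lee_fin le_eqVlt; apply/predU1P; left; ring.
rewrite -lee_fin EFin_normr_Rintegral//.
apply: le_trans (le_abse_integral _ _ _) _ => //; first exact: measurable_int iB.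
apply: le_trans (ge0_le_integral _ _ _ _ _ _) (le_trans Ib _) => //.
- by apply: measurableT_comp => //; exact: measurable_int iB.
- by rewrite /b; under eq_fun do rewrite EFinD !EFinM -EFinM; apply: emeasurable_funD; exact: measurable_funeM.
- by move=> s _; rewrite lee_fin; exact: hb.
- by rewrite lee_fin [leRHS]splitr; apply: lerD; [exact: etaK|exact: dQ].
Qed.

End duhamel_continuity.

(** * Picard iteration *)

Section power_nonlinearity.
Context {R : realType} (p : R).
Hypothesis p1 : 1 < p.

Lemma measurable_Fp : measurable_fun setT (Fp p).
Proof.
apply: measurable_funM => //.
by apply: (measurableT_comp (measurable_powR (p - 1))).
Qed.

Let powRB_le (a b m : R) : 0 <= b -> b <= a -> a <= m ->
  a `^ p - b `^ p <= p * m `^ (p - 1) * (a - b).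
Proof.
move=> b0 ba am; have p0 : 0 < p by exact: lt_trans p1.
have m0 : 0 <= m by apply: le_trans am; exact: le_trans ba.
have mono (c : R) : 0 <= c -> c <= m -> p * c `^ (p - 1) <= p * m `^ (p - 1).
  move=> c0 cm; rewrite ler_wpM2l ?(ltW p0)//.
  have : 0 <= p - 1 by rewrite subr_ge0 ltW.
  by move=> /ge0_ler_powR; apply; rewrite ?nnegrE.
(* The derivative of the power is only available at positive points, so [b = 0] is treated by
   [a^p = a^(p-1) a] and [p >= 1]. *)
have [b00|b00] := eqVneq b 0.
  rewrite b00 powR0 ?gt_eqF// !subr0 -mulr_powRB1 ?(le_trans b0)// mulrC.
  rewrite ler_wpM2r ?(le_trans b0)//.
  apply: le_trans (mono _ (le_trans b0 ba) am).
  by rewrite ler_peMl ?powR_ge0// ltW.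
have {}b0 : 0 < b by rewrite lt_neqAle eq_sym b00.
have dp (x : R) : x \in `]b, a[ -> is_derive x 1 (@powR R ^~ p) (p * x `^ (p - 1)).
  by rewrite in_itv/= => /andP[bx _]; apply: is_derive1_powR; exact: lt_trans bx.
have cp : {within `[b, a], continuous (@powR R ^~ p)}.
  apply: derivable_within_continuous => x; rewrite in_itv/= => /andP[bx _].
  by apply: ex_derive; apply: is_derive1_powR; exact: lt_le_trans bx.
have [c] := MVT_segment ba dp cp.
rewrite in_itv/= => /andP[bc ca] ->; rewrite ler_wpM2r ?subr_ge0// mono//.
  by rewrite (le_trans (ltW b0)).
exact: le_trans am.
Qed.

Lemma FpN (a : R) : Fp p (- a) = - Fp p a.
Proof. by rewrite /Fp normrN mulrN. Qed.

Lemma Fp0 : Fp p 0 = 0.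
Proof. by rewrite /Fp mulr0. Qed.

Lemma norm_FpB_le (a b m : R) : `|a| <= m -> `|b| <= m ->
  `|Fp p a - Fp p b| <= p * m `^ (p - 1) * `|a - b|.
Proof.
have FpE (c : R) : 0 <= c -> Fp p c = c `^ p.
  by move=> c0; rewrite /Fp ger0_norm// mulrC mulr_powRB1// (lt_trans ltr01).
have p0 : 0 < p by exact: lt_trans p1.
have same (c d : R) : 0 <= d -> d <= c -> c <= m ->
    `|Fp p c - Fp p d| <= p * m `^ (p - 1) * `|c - d|.
  move=> d0 dc cm; rewrite !FpE ?(le_trans d0 dc)// !ger0_norm ?subr_ge0//.
    exact: powRB_le.
  by move/ltW: p0 => /ge0_ler_powR; apply; rewrite ?nnegrE ?(le_trans d0 dc).
have nneg (c d : R) : 0 <= c -> c <= m -> `|d| <= m ->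
    `|Fp p c - Fp p d| <= p * m `^ (p - 1) * `|c - d|.
  move=> c0 cm dm; have [d0|d0] := leP 0 d.
    have [dc|/ltW cd] := leP d c; first exact: same.
    rewrite distrC (distrC c); apply: same => //.
    by rewrite -(ger0_norm d0).
  (* For opposite signs oddness turns both differences into sums, and each term is compared with its
     value at 0. *)
  have [e [e0 de]] : exists e, 0 <= e /\ d = - e.
    by exists (- d); rewrite opprK oppr_ge0 ltW.
  have em : e <= m by rewrite de normrN ger0_norm// in dm.
  have z c' : 0 <= c' -> c' <= m -> Fp p c' <= p * m `^ (p - 1) * c'.
    move=> c'0 c'm; have := powRB_le (lexx 0) c'0 c'm.
    by rewrite powR0 ?gt_eqF// !subr0 FpE.
  have F0 c' : 0 <= c' -> 0 <= Fp p c' by move=> h; rewrite FpE ?powR_ge0.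
  rewrite de FpN !opprK (ger0_norm (addr_ge0 (F0 _ c0) (F0 _ e0))).
  by rewrite (ger0_norm (addr_ge0 c0 e0)) mulrDr lerD// z.
move=> am bm; have [a0|a0] := leP 0 a.
  by apply: nneg => //; rewrite -(ger0_norm a0).
have := nneg (- a) (- b); rewrite oppr_ge0 normrN !FpN => /(_ (ltW a0) _ bm).
rewrite -!opprD !normrN; apply.
by apply: le_trans am; rewrite ltr0_norm.
Qed.

End power_nonlinearity.

Lemma le_halving_eq0 {R : realType} (z c : R) :
  (forall n : nat, `|z| <= c * 2 ^- n) -> z = 0.
Proof.
move=> h; apply/eqP; rewrite -normr_eq0; apply/negP => /negP z0.
have {z0} z0 : 0 < `|z| by rewrite lt_neqAle eq_sym z0 normr_ge0.
have c0 : 0 <= c / `|z|.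
  by rewrite divr_ge0// (le_trans (ltW z0))//; have := h 0%N; rewrite expr0 invr1 mulr1.
have := h (Num.bound (c / `|z|)); rewrite leNgt => /negP; apply.
rewrite ltr_pdivrMr ?exprn_gt0// mulrC -ltr_pdivrMr//.
apply: lt_trans (archi_boundP c0) _.
by rewrite -natrX ltr_nat ltn_expl.
Qed.

Lemma cvg_halving {R : realType} (f : nat -> R) (c : R) :
  (forall n, `|f n.+1 - f n| <= c * 2 ^- n) ->
  exists l, f @ \oo --> l /\ forall n, `|l - f n| <= 2 * c * 2 ^- n.
Proof.
(* Keeping the subtracted tail of the geometric sum is what lets the induction on [k] close. *)
move=> fc; have h n k : `|f (n + k)%N - f n| <= 2 * c * 2 ^- n - 2 * c * 2 ^- (n + k).
  elim: k => [|k IH]; first by rewrite addn0 !subrr normr0.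
  rewrite addnS -(subrK (f (n + k)%N) (f _.+1)) -addrA.
  apply: le_trans (ler_normD _ _) (le_trans (lerD (fc _) IH) _).
  rewrite le_eqVlt; apply/predU1P; left.
  rewrite exprS; field; rewrite ?expf_neq0//.
have c0 : 0 <= c by have := fc 0%N; rewrite expr0 invr1 mulr1; apply: le_trans.
have h' n k : `|f (n + k)%N - f n| <= 2 * c * 2 ^- n.
  by apply: le_trans (h n k) _; rewrite gerBl !mulr_ge0 ?invr_ge0 ?exprn_ge0.
have cf : cvgn f.
  pose u n := f n.+1 - f n.
  have /normed_cvg cu : cvgn [normed series u].
    apply: (series_le_cvg (v_ := geometric c 2^-1)).
    - by move=> n; exact: normr_ge0.
    - by move=> n; rewrite /geometric/= mulr_ge0// exprn_ge0.
    - by move=> n; rewrite /geometric/= exprVn; exact: fc.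
    - by apply: is_cvg_geometric_series; rewrite ger0_norm// invf_lt1// ltr1n.
  have -> : f = (fun n => series u n + f 0%N).
    by apply/funext => n; rewrite /series/= telescope_sumr// subrK.
  by apply: is_cvgD => //; exact: is_cvg_cst.
exists (limn f); split=> // n; apply/ler_addgt0Pr => e e0.
have /cvgrPdist_le/(_ e e0)[M _ hM] := cf.
rewrite -(subrK (f (n + M)%N) (limn f)) -addrA.
apply: le_trans (ler_normD _ _) _; rewrite [leRHS]addrC; apply: lerD; last exact: h'.
by apply: hM => /=; rewrite leq_addl.
Qed.

Section fixed_point.
Context {R : realType} {N : nat} (p beta a : R).
Hypothesis p1 : 1 < p.
Hypothesis betap : beta * (p - 1) = 4.
Hypothesis beta0 : 0 < beta.
Hypothesis beta_a : beta < a.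
Hypothesis aN : a < N%:R.
Hypothesis a_beta4 : a < beta + 4.
Implicit Types (x y : 'rV[R]_N) (v : 'rV[R]_N -> R -> R).

Let weight x (t : R) : R := pnorm x t `^ (- beta).

Let weight_gt0 x t : 0 < t -> 0 < weight x t.
Proof. by move=> t0; rewrite powR_gt0// pnorm_gt0. Qed.

Definition weighted_bounded (K : R) v :=
  measurable_fun setT (fun z : 'rV[R]_N * R => v z.1 z.2) /\
  forall x (t : R), 0 < t -> `|v x t| <= K * weight x t.

Let source v : R -> 'rV[R]_N -> R := fun s y => Fp p (v y s).

Let measurable_nonlinear v : measurable_fun setT (fun z : 'rV[R]_N * R => v z.1 z.2) ->
  measurable_fun setT (fun z : 'rV[R]_N * R => source v z.2 z.1).
Proof. exact: (measurableT_comp (measurable_Fp p)). Qed.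

Let sourceB_le (K D : R) v v' x t : 0 <= K -> 0 < t ->
  `|v x t| <= K * weight x t -> `|v' x t| <= K * weight x t ->
  `|v x t - v' x t| <= D * weight x t ->
  `|Fp p (v x t) - Fp p (v' x t)| <=
     p * K `^ (p - 1) * D * pnorm x t `^ (- (beta + 4)).
Proof.
move=> K0 t0 h h' hD; have p0 : 0 < p by exact: lt_trans p1.
apply: le_trans (norm_FpB_le p1 h h') _.
have w0 := weight_gt0 x t0; have n0 := pnorm_gt0 x t0.
rewrite powRM ?(ltW w0)//.
have wE : weight x t `^ (p - 1) = pnorm x t `^ (- 4).
  by rewrite /weight -powRrM mulNr betap.
have -> : pnorm x t `^ (- (beta + 4)) = pnorm x t `^ (- 4) * weight x t.
  by rewrite /weight -powRD ?(gt_eqF n0) ?implybT//; congr powR; ring.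
rewrite wE [leRHS](_ : _ = p * (K `^ (p - 1) * pnorm x t `^ (- 4)) * (D * weight x t)); last by ring.
apply: ler_wpM2l; last exact: hD.
by rewrite !mulr_ge0 ?powR_ge0// ltW.
Qed.

Lemma source_bounded_Fp (K : R) v : 0 <= K -> weighted_bounded K v ->
  source_bounded beta (p * K `^ (p - 1) * K) (source v).
Proof.
move=> K0 [mv hv]; split; first exact: measurable_nonlinear.
move=> s y s0.
have := @sourceB_le K K v (fun _ _ => 0) y s K0 s0 (hv y s s0).
rewrite Fp0 subr0 normr0 subr0; apply; last exact: hv.
by rewrite mulr_ge0// powR_ge0.
Qed.

Lemma source_bounded_FpB (K D : R) v v' : 0 <= K ->
  weighted_bounded K v -> weighted_bounded K v' ->
  (forall x (t : R), 0 < t -> `|v x t - v' x t| <= D * weight x t) ->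
  source_bounded beta (p * K `^ (p - 1) * D) (fun s y => source v s y - source v' s y).
Proof.
move=> K0 [mv hv] [mv' hv'] hD; split.
  by apply: measurable_funB; exact: measurable_nonlinear.
by move=> s y s0; apply: sourceB_le => //; [exact: hv|exact: hv'|exact: hD].
Qed.

(** The smallness condition serves twice: with [lin] of size [K/2] it keeps the iterates below [K],
    and it makes the map contract by [1/2] in the weighted norm. Convergence is then geometric at
    each point. *)
Lemma picard_fixed_point : exists B : R, 0 < B /\
  forall (K : R) (lin : 'rV[R]_N -> R -> R), 0 <= K ->
  B * (p * K `^ (p - 1)) <= 2^-1 -> weighted_bounded (K / 2) lin ->
  exists u, [/\ weighted_bounded K u, source_bounded beta (p * K `^ (p - 1) * K) (source u) &
    forall x (t : R), 0 < t -> u x t = lin x t + duhamel (source u) x t].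
Proof.
have [B [B0 hB]] := @duhamel_le R N _ _ beta0 beta_a aN a_beta4.
exists B; split=> // K lin K0 Bk [mlin hlin].
have p0 : 0 < p by exact: lt_trans p1.
pose L := p * K `^ (p - 1).
have L0 : 0 <= L by rewrite mulr_ge0 ?powR_ge0// ltW.
(* The value 0 at nonpositive times makes the iterates converge everywhere, so that their limit is
   measurable on the whole space-time. *)
pose T v x (t : R) := if 0 < t then lin x t + duhamel (source v) x t else 0.
have mT v : weighted_bounded K v ->
    measurable_fun setT (fun z : 'rV[R]_N * R => T v z.1 z.2).
  move=> [mv _]; apply: measurable_fun_ifT => //.
    exact: measurable_fun_ltr.
  apply: measurable_funD => //.
  by apply: measurable_duhamel; exact: measurable_nonlinear mv.
have TK v : weighted_bounded K v -> weighted_bounded K (T v).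
  move=> bv; split; first exact: mT.
  move=> x t t0; rewrite /T t0; apply: le_trans (ler_normD _ _) _.
  have [_ h] := hB _ _ x t (mulr_ge0 L0 K0) (source_bounded_Fp K0 bv) t0.
  apply: le_trans (lerD (hlin x t t0) h) _; rewrite -/(weight x t).
  have w0 := weight_gt0 x t0.
  rewrite -mulrDl; apply: ler_wpM2r; first exact: ltW.
  have BLK : B * (L * K) <= 2^-1 * K by rewrite mulrA; exact: ler_wpM2r.
  apply: le_trans (lerD (lexx _) BLK) _; lra.
have TB (v v' : 'rV[R]_N -> R -> R) (D : R) : 0 <= D -> weighted_bounded K v -> weighted_bounded K v' ->
    (forall x (t : R), 0 < t -> `|v x t - v' x t| <= D * weight x t) ->
    forall x (t : R), 0 < t -> `|T v x t - T v' x t| <= D / 2 * weight x t.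
  move=> D0 bv bv' hD x t t0; rewrite /T t0 opprD addrACA subrr add0r.
  rewrite (@duhamelB R N _ _ beta0 beta_a aN a_beta4 _ _ _ _ x t (mulr_ge0 L0 K0) (mulr_ge0 L0 K0)
    (source_bounded_Fp K0 bv) (source_bounded_Fp K0 bv') t0).
  have [_ h] := hB _ _ x t (mulr_ge0 L0 D0) (source_bounded_FpB K0 bv bv' hD) t0.
  apply: le_trans h _; apply: ler_wpM2r; first exact: powR_ge0.
  rewrite mulrA mulrC; apply: ler_wpM2l; [exact: D0|exact: Bk].
pose u (n : nat) := iter n T (fun _ _ => 0).
have bu n : weighted_bounded K (u n).
  elim: n => [|n IH]; last exact: TK.
  split; first exact: measurable_cst.
  by move=> x t t0; rewrite normr0 mulr_ge0 ?powR_ge0.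
have du n x t : 0 < t -> `|u n.+1 x t - u n x t| <= K * 2 ^- n * weight x t.
  elim: n x t => [|n IH] x t t0.
    by rewrite expr0 invr1 mulr1 subr0; have [_] := bu 1%N; apply.
  have := TB _ _ (K * 2 ^- n) _ (bu n.+1) (bu n) IH x t t0.
  rewrite exprSr invfM mulrA; apply.
  by rewrite mulr_ge0// invr_ge0 exprn_ge0.
have cu x t : exists l, u ^~ x ^~ t @ \oo --> l /\
    (0 < t -> forall n, `|l - u n x t| <= 2 * (K * weight x t) * 2 ^- n).
  have [t0|t0] := ltP 0 t.
    have [|l [ul hl]] := @cvg_halving R (fun n => u n x t) (K * weight x t).
      by move=> n; rewrite mulrAC; exact: du.
    by exists l.
  exists 0; split=> //; apply: (@cvg_near_cst _ _ _ _ _ _ _).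
  by apply: nearW => -[|n] //=; rewrite /u /= /T ltNge t0.
have [w hw] := choice (fun z : 'rV[R]_N * R => cu z.1 z.2).
pose v x t := w (x, t).
have vl x t : 0 < t -> forall n, `|v x t - u n x t| <= 2 * K * 2 ^- n * weight x t.
  move=> t0 n; have [_ /(_ t0 n)] := hw (x, t).
  by rewrite [2 * K * _ * _]mulrAC mulrA.
have bv : weighted_bounded K v.
  split.
    apply: (measurable_fun_cvg (h := fun n (z : 'rV[R]_N * R) => u n z.1 z.2)).
      by move=> n; have [] := bu n.
    by move=> [x t] _; have [] := hw (x, t).
  move=> x t t0; apply/ler_addgt0Pr => e e0.
  have [h _] := hw (x, t).
  have /cvgrPdist_le/(_ e e0)[M _ /(_ M (leqnn M))/= hM] := h.
  rewrite -(subrK (u M x t) (v x t)).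
  apply: le_trans (ler_normD _ _) _; rewrite [leRHS]addrC; apply: lerD; first exact: hM.
  by have [_] := bu M; apply.
exists v; split=> //; first exact: source_bounded_Fp.
move=> x t t0; apply/eqP; rewrite -subr_eq0; apply/eqP.
(* Both [|v - u n.+1|] and [|T (u n) - T v|] are at most [K 2^(-n)] times the weight: the former by
   the speed of convergence, the latter by contraction. *)
apply: (@le_halving_eq0 _ _ (2 * K * weight x t)) => n.
have h1 := TB v (u n) (2 * K * 2 ^- n) _ bv (bu n) (fun x t t0 => vl x t t0 n) x t t0.
have h2 := vl x t t0 n.+1.
have -> : lin x t + duhamel (source v) x t = T v x t by rewrite /T t0.
rewrite -(subrK (u n.+1 x t) (v x t)) -addrA.
apply: le_trans (ler_normD _ _) _.
rewrite [X in _ + X]distrC.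
apply: le_trans (lerD h2 (h1 _)) _.
  by rewrite !mulr_ge0// invr_ge0 exprn_ge0.
rewrite le_eqVlt; apply/predU1P; left; rewrite exprS; field.
by rewrite expf_neq0.
Qed.

End fixed_point.

(** * The singular datum *)

Section euclidean_norm.
Context {R : realType} {N : nat}.
Implicit Types x : 'rV[R]_N.

Lemma norm_le_enorm x : `|x| <= enorm x.
Proof.
have [->|x0] := eqVneq x 0; first by rewrite normr0 sqrtr_ge0.
have [i ->] := norm_eq_coord x0.
rewrite -sqrtr_sqr ler_wsqrtr//; exact: coord_sqr_le_dotr.
Qed.

Lemma enorm_le_norm x : enorm x <= N%:R * `|x|.
Proof.
rewrite -(@ger0_norm _ (N%:R * `|x|)) ?mulr_ge0// -sqrtr_sqr ler_wsqrtr//.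
apply: (@le_trans _ _ (\sum_(i < N) `|x| ^+ 2)).
  apply: ler_sum => i _; rewrite -expr2 -real_normK ?num_real//.
  by rewrite lerXn2r ?nnegrE// coord_le_norm.
rewrite sumr_const card_ord -[leLHS]mulr_natl exprMn ler_wpM2r ?sqr_ge0//.
by rewrite -natrX ler_nat -mulnn; case: N => // n; rewrite leq_pmulr.
Qed.

Lemma measurable_enorm : measurable_fun setT (@enorm R N).
Proof.
have -> : @enorm R N = fun x => dotr x x `^ 2^-1.
  by apply/funext => x; rewrite powR12_sqrt// dotrr_ge0.
apply: (measurableT_comp (measurable_powR _)).
exact: measurable_dotr.
Qed.

End euclidean_norm.

Section singular_datum.
Context {R : realType} {N : nat} (beta : R).
Hypothesis beta0 : 0 < beta.
Hypothesis betaN : beta < N%:R.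
Let phi (x : 'rV[R]_N) : R := enorm x `^ (- beta).

Let phi_ge0 x : 0 <= phi x.
Proof. exact: powR_ge0. Qed.

Lemma measurable_enorm_powR : measurable_fun setT phi.
Proof. exact: (measurableT_comp (measurable_powR (- beta)) measurable_enorm). Qed.

(* At the origin both sides vanish, [0 `^ (- beta)] being [0]. *)
Let phi_le x : phi x <= `|x| `^ (- beta).
Proof.
have [->|x0] := eqVneq x 0.
  have -> : phi 0 = 0; last exact: powR_ge0.
  apply/eqP; rewrite powR_eq0 oppr_eq0 (gt_eqF beta0) andbT eq_le sqrtr_ge0 andbT.
  by have := enorm_le_norm (0 : 'rV[R]_N); rewrite normr0 mulr0.
rewrite -normr_gt0 in x0; have e0 := lt_le_trans x0 (norm_le_enorm x).
rewrite /phi !powRN lef_pV2; [|by rewrite posrE powR_gt0..].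
have /ltW := beta0; move=> /ge0_ler_powR; apply; rewrite ?nnegrE ?(ltW e0)//.
exact: norm_le_enorm.
Qed.

Lemma conv_bounded_enorm_powR : exists A : R, 0 < A /\ conv_bounded beta A phi.
Proof.
have [|A [A0 hA]] := @conv_maj_powR_le R N beta; first by rewrite beta0.
exists A; split=> //; split; first exact: measurable_enorm_powR.
move=> tau x t0; apply: le_trans (hA tau x t0); apply: ge0_le_integral => //.
- by move=> y _; rewrite lee_fin mulr_ge0 ?maj_ge0// ltW.
- apply/measurable_EFinP/measurable_funM; first exact: measurable_maj.
  exact: (measurableT_comp _ measurable_enorm_powR).
- apply/measurable_EFinP/measurable_funM; first exact: measurable_maj.
  exact: (measurableT_comp (measurable_powR (- beta)) measurable_norm_rV).
- move=> y _; rewrite lee_fin ger0_norm//; apply: ler_wpM2l; last exact: phi_le.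
  by rewrite maj_ge0// ltW.
Qed.

(** On [|y| <= r] the majorant at scale [r] is the constant [r^(-N)], so the convolution bound at
    the origin controls the integral over any set inside that ball. *)
Lemma locally_integrable_enorm_powR : locally_integrable_rV phi.
Proof.
have mphi := measurable_enorm_powR.
split=> // K /compact_bounded[M [_ /(_ (Num.max M 0 + 1))]] hM.
have {hM} hM : forall x, K x -> `|x| <= Num.max M 0 + 1.
  by apply: hM; rewrite ltr_pwDr// le_max lexx.
set r := Num.max M 0 + 1 in hM.
have r0 : 0 < r by rewrite ltr_pwDr// le_max lexx orbT.
have [A [A0 [_ hA]]] := conv_bounded_enorm_powR.
have mg : measurable_fun setT (fun y : 'rV[R]_N => (maj r (0 - y) * `|phi y|)%:E).
  apply/measurable_EFinP/measurable_funM; first exact: measurable_maj.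
  exact: measurableT_comp.
have g0 y : 0 <= maj r (0 - y) * `|phi y| by rewrite mulr_ge0// maj_ge0// ltW.
have rg0 y : (0 <= (r ^+ N)%:E * (maj r (0 - y) * `|phi y|)%:E)%E.
  by rewrite -EFinM lee_fin mulr_ge0// exprn_ge0// ltW.
apply/integrableP; split; first by apply: measurable_funTS; exact/measurable_EFinP.
rewrite integral_mkcond.
apply: (@le_lt_trans _ _ (\int[lebesgue_rV R N]_y
   ((r ^+ N)%:E * (maj r (0 - y) * `|phi y|)%:E))%E); last first.
  rewrite ge0_integralZl//.
  - apply: (@le_lt_trans _ _ ((r ^+ N)%:E * (A * Num.max `|0 : 'rV[R]_N| r `^ (- beta))%:E)%E).
      by rewrite lee_wpmul2l ?lee_fin ?exprn_ge0 ?(ltW r0)//; exact: hA.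
    by rewrite -EFinM ltry.
  - by move=> y _; rewrite lee_fin.
  - by rewrite lee_fin exprn_ge0// ltW.
(* [K] need not be known to be measurable: the nonnegative integral is a
   supremum, hence monotone. *)
rewrite !ge0_integralTE; last 2 first.
- exact: rg0.
- by move=> y; rewrite erestrict_ge0.
apply: le_ereal_sup => _ [h /= hle <-]; exists h => //= y.
apply: le_trans (hle y) _; rewrite /patch; case: ifPn => [|_]; last first.
  exact: rg0.
rewrite inE => /hM yr; rewrite -EFinM lee_fin mulrA ler_peMl//.
rewrite /maj sub0r normrN (max_idPl yr) mulrA -exprD addnn -mul2n divff//.
by rewrite expf_neq0// gt_eqF.
Qed.

Lemma bounded_at_infinity_enorm_powR : bounded_at_infinity phi.
Proof.
exists 1, 1; split; first exact: num_real.
move=> M M1 x /= x1; rewrite ger0_norm//; apply: le_trans (ltW M1).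
rewrite /phi powRN invf_le1; last by rewrite powR_gt0// (lt_trans _ x1).
by rewrite -(powRr0 (enorm x)) ler_powR// ltW.
Qed.

End singular_datum.

(** * Assembling the solution *)

Lemma continuous_BC_unif {R : realType} {N : nat} (u : 'rV[R]_N -> R -> R) :
  (forall t, 0 < t -> unif_continuous_at u t) ->
  (forall t, 0 < t -> exists B : R, forall x, `|u x t| <= B) -> continuous_BC u.
Proof.
move=> cu bu; split=> [t t0|t].
  split=> [x|].
    apply/(@cvgrPdist_le _ _ _ (nbhs x) (nbhs_filter x)) => e e0; have [eta [eta0 h]] := cu t t0 e e0.
    apply/nbhs_ballP; exists eta => //= y; rewrite -ball_normE/= => xy.
    by apply: h => //; rewrite subrr normr0.
  have [B hB] := bu t t0; exists B; split; first exact: num_real.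
  by move=> M BM x _ /=; apply: le_trans (hB x) (ltW BM).
rewrite inE/= in_itv/= andbT => t0.
move=> P /uniform_nbhs[E [entE hE]].
have [e /= e0 eE] : exists2 e : R, 0 < e & [set xy | ball xy.1 e xy.2] `<=` E.
  by move: entE; rewrite -entourage_ballE => -[e e0 he]; exists e.
have e20 : 0 < e / 2 by rewrite divr_gt0.
have [eta [eta0 h]] := cu t t0 (e / 2) e20.
apply/nbhs_ballP; exists eta => //= s; rewrite /ball/= => ts.
apply: hE => y _; apply: eE => /=; rewrite /ball/=.
apply: (@le_lt_trans _ _ (e / 2)); last by rewrite ltr_pdivrMr// ltr_pMr// ltr1n.
by apply: h => //; rewrite subrr normr0.
Qed.

Lemma unif_continuous_semigroup {R : realType} {N : nat} (a B : R) (f : 'rV[R]_N -> R) (t : R) :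
  0 <= a -> 0 <= B -> conv_bounded a B f -> 0 < t ->
  unif_continuous_at (fun x t => biharmonic_semigroup t f x) t.
Proof.
move=> a0 B0 fB t0 e e0.
have t20 : 0 < t / 2 by rewrite divr_gt0.
have [C [C0 hC]] := @semigroupB_le R N (t / 2) (2 * t) t20.
have CB0 : 0 <= C * B by rewrite mulr_ge0// ltW.
have [eta [eta0 etat eta1 he]] := exists_sqrt_small CB0 t20 e0.
exists eta; split=> // x y t' xy tt'.
have /ltr_normlP[tt1 tt2] := tt'.
apply: le_trans (hC a B f x y t t' a0 B0 fB _ _ _) _.
- by apply/andP; split; lra.
- by apply/andP; split; lra.
- by apply: ltW; exact: lt_le_trans eta1.
apply: le_trans he; rewrite mulrAC ler_wpM2l// ler_wsqrtr//.
by rewrite mulr_natl mulr2n; apply: lerD; exact: ltW.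
Qed.

Theorem theorem1p4 (R : realType) (N : nat) (p : R) (hN : (1 <= N)%N)
    (hp : 1 + 4 / N%:R < p) :
  let beta : R := 4 / (p - 1) in
  let phi := fun x : 'rV[R]_N => enorm x `^ (- beta) in
  exists M : R, 0 < M /\
    exists eps0 : R, 0 < eps0 /\
      forall eps : R, 0 < eps < eps0 ->
        exists u : 'rV[R]_N -> R -> R,
          global_solution p eps phi u /\
          forall (x : 'rV[R]_N) (t : R), 0 < t ->
            `|u x t| <= eps * M / (enorm x `^ beta + t `^ (beta / 4)).
Proof.
move=> beta phi.
have N0 : (0 : R) < N%:R by rewrite ltr0n.
have N4 : (0 : R) < 4 / N%:R by rewrite divr_gt0.
have p1 : 1 < p by apply: lt_trans hp; rewrite ltrDl.
have p10 : 0 < p - 1 by rewrite subr_gt0.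
have p0 : 0 < p by exact: lt_trans p1.
have beta0 : 0 < beta by rewrite divr_gt0.
have betap : beta * (p - 1) = 4 by rewrite divfK// gt_eqF.
have betaN : beta < N%:R.
  by rewrite ltr_pdivrMr// mulrC -ltr_pdivrMr// ltrBrDl.
pose m := Num.min N%:R (beta + 4).
have bm : beta < m.
  by rewrite lt_min betaN /= -[ltLHS]addr0 ltrD2l ltr0n.
have [a [beta_a aN a_beta4]] : exists a, [/\ beta < a, a < N%:R & a < beta + 4].
  have mN : m <= N%:R by rewrite ge_min lexx.
  have m4 : m <= beta + 4 by rewrite ge_min lexx orbT.
  by exists ((beta + m) / 2); split; lra.
have [A [A0 hphi]] := conv_bounded_enorm_powR beta0 betaN.
rewrite -/phi in hphi.
have [C [C0 hC]] := @semigroup_le R N.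
have [B [B0 hB]] := @picard_fixed_point R N p beta a p1 betap beta0 beta_a aN a_beta4.
(* With [K = eps A2] the free evolution has size [eps C A = K/2], as the fixed point lemma
   requires. *)
pose A2 := 2 * (C * A).
have A20 : 0 < A2 by rewrite !mulr_gt0.
have Nb0 : 0 <= N%:R `^ beta :> R by exact: powR_ge0.
(* Converts the sup-norm weight into the stated one: [enorm x <= N pnorm x t] accounts for [N^beta],
   and [root4 t <= pnorm x t] for the 1. *)
exists (A2 * (N%:R `^ beta + 1)); split; first by rewrite mulr_gt0// ltr_wpDl.
pose theta := (2 * p * B)^-1.
have theta0 : 0 < theta by rewrite invr_gt0 !mulr_gt0.
exists (theta `^ (p - 1)^-1 / A2); split; first by rewrite divr_gt0// powR_gt0.
move=> eps /andP[eps_gt0]; rewrite ltr_pdivlMr// => epsA.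
pose K := eps * A2.
have K0 : 0 <= K by rewrite mulr_ge0 ?ltW.
have small : B * (p * K `^ (p - 1)) <= 2^-1.
  have KE : K `^ (p - 1) <= theta.
    rewrite [leRHS](_ : _ = (theta `^ (p - 1)^-1) `^ (p - 1)); last first.
      by rewrite -powRrM mulVf ?gt_eqF// powRr1// ltW.
    by move/ltW: p10 => /ge0_ler_powR; apply; rewrite ?nnegrE ?powR_ge0// ltW.
  apply: le_trans (_ : B * (p * theta) <= _).
    by rewrite ler_wpM2l ?(ltW B0)// ler_wpM2l ?(ltW p0).
  rewrite /theta le_eqVlt; apply/predU1P; left; field.
  by rewrite !gt_eqF.
pose lin (x : 'rV[R]_N) t := eps * biharmonic_semigroup t phi x.
have blin : weighted_bounded beta (K / 2) lin.
  split.
    apply: measurable_funM => //.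
    (* Joint measurability of the free evolution is read off the Duhamel integrand of the source
       [phi], constant in time, at [s = 0]. *)
    have mphi : measurable_fun setT (fun z : 'rV[R]_N * R => phi z.1).
      exact: (measurableT_comp (measurable_enorm_powR beta)).
    have mz : measurable_fun setT (fun z : 'rV[R]_N * R => (z, 0 : R)).
      exact: measurable_pair2.
    have := measurableT_comp (measurable_duhamel_integrand (F := fun=> phi) mphi) mz.
    by apply: eq_measurable_fun => z _ /=; rewrite subr0.
  move=> x t t0; have [_ h] := hC _ _ _ x _ hphi t0.
  rewrite normrM gtr0_norm// [leRHS](_ : _ = eps * (C * (A * pnorm x t `^ (- beta)))).
    by rewrite ler_wpM2l// ltW.
  by rewrite /K /A2; field.
have [u [[mu bu] su ueq]] := hB K lin K0 small blin.
have L0 : 0 <= p * K `^ (p - 1) * K by rewrite !mulr_ge0 ?powR_ge0// ltW.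
have [C1 [_ hS]] := @semigroup_source_le R N _ _ beta0 beta_a aN a_beta4.
have [C2 [_ hD]] := @duhamel_le R N _ _ beta0 beta_a aN a_beta4.
exists u; split; last first.
  move=> x t t0; apply: le_trans (bu x t t0) _.
  have q0 : 0 < pnorm x t by exact: pnorm_gt0.
  have d0 : 0 < enorm x `^ beta + t `^ (beta / 4).
    by rewrite ltr_wpDl ?powR_ge0// powR_gt0.
  rewrite ler_pdivlMr// /K -[leLHS]mulrA -[leLHS]mulrA.
  apply: ler_wpM2l; first exact: ltW.
  apply: ler_wpM2l; first exact: ltW.
  rewrite powRN [leLHS]mulrC ler_pdivrMr ?powR_gt0// mulrDl mul1r.
  have mono (y z : R) : 0 <= y -> y <= z -> y `^ beta <= z `^ beta.
    move=> y0 yz; move/ltW: beta0 => /ge0_ler_powR; apply; rewrite ?nnegrE//.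
    exact: le_trans yz.
  apply: lerD.
    rewrite -powRM ?(ltW q0)//; apply: mono; first exact: sqrtr_ge0.
    apply: le_trans (enorm_le_norm x) _; rewrite ler_wpM2l//.
    by rewrite /pnorm le_max lexx.
  rewrite -root4_powR; apply: mono; first exact: root4_ge0.
  by rewrite /pnorm le_max lexx orbT.
split.
- split; first exact: locally_integrable_enorm_powR.
  exact: bounded_at_infinity_enorm_powR.
- apply: continuous_BC_unif => t t0; last first.
    exists (K * root4 t `^ (- beta)) => x; apply: le_trans (bu x t t0) _.
    rewrite ler_wpM2l// !powRN lef_pV2; [|by rewrite posrE powR_gt0// ?pnorm_gt0 ?root4_gt0..].
    move/ltW: beta0 => /ge0_ler_powR; apply; rewrite ?nnegrE ?root4_ge0 ?(ltW (pnorm_gt0 _ _))//.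
    by rewrite /pnorm le_max lexx orbT.
  move=> e e0.
  have e1 : 0 < e / 2 / eps by rewrite !divr_gt0.
  have e2 : 0 < e / 2 by rewrite divr_gt0.
  have [n1 [n10 h1]] := unif_continuous_semigroup (ltW beta0) (ltW A0) hphi t0 e1.
  have [n2 [n20 h2]] := duhamel_unif_continuous beta0 beta_a aN a_beta4 L0 su t0 e2.
  (* The bound by [t] keeps [t'] positive, where the integral equation for [u] is available. *)
  exists (Num.min (Num.min n1 n2) t); split; first by rewrite !lt_min n10 n20.
  move=> x y t'; rewrite !lt_min => /andP[/andP[xy1 xy2] _] /andP[/andP[tt1 tt2]].
  move=> /ltr_normlP[_ tt].
  have t'0 : 0 < t' by lra.
  rewrite !ueq// opprD addrACA [leRHS]splitr.
  apply: le_trans (ler_normD _ _) (lerD _ _); last exact: h2.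
  rewrite /lin -mulrBr normrM gtr0_norm// mulrC -ler_pdivlMr//; exact: h1.
- move=> x t t0 Fpu; split.
  + by have [] := hC _ _ _ x _ hphi t0.
  + by move=> s st; have [] := hS _ _ x _ _ L0 su st.
  + by have [] := hD _ _ x _ L0 su t0.
  + exact: ueq.
Qed.
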